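(* Let $(M,H,G)$ be a quaternionic Kähler manifold with NH-metric structure (a quaternionic Kähler NH-manifold) of dimension $4n\ge 8$. Then $(M,H,G)$ is Einstein.
   Context: $M$ is a differentiable manifold of dimension $4n$. An almost hypercomplex structure on $M$ is a triple $H=(J_1,J_2,J_3)$ of almost complex structures with $J_\alpha=J_\beta\circ J_\gamma=-J_\gamma\circ J_\beta$ and $J_\alpha^2=-I$ for all cyclic permutations $(\alpha,\beta,\gamma)$ of $(1,2,3)$. Put $\varepsilon_1=1$, $\varepsilon_2=\varepsilon_3=-1$. An NH-metric structure $G=(g,g_1,g_2,g_3)$ on $(M,H)$ consists of a pseudo-Riemannian metric $g$ of neutral signature $(2n,2n)$ with $g(x,y)=\varepsilon_\alpha g(J_\alpha x,J_\alpha y)$ for $\alpha=1,2,3$, together with $g_\alpha(x,y)=g(J_\alpha x,y)=-\varepsilon_\alpha g(x,J_\alpha y)$ (so $g_1$ is a 2-form and $g_2,g_3$ are symmetric). $(M,H,G)$ is then an almost hypercomplex NH-manifold. Let $\nabla$ be the Levi-Civita connection of $g$. $(M,H,G)$ is a quaternionic Kähler NH-manifold if there are local 1-forms $\omega_1,\omega_2,\omega_3$ with $(\nabla_xJ_\alpha)y=\omega_\gamma(x)J_\beta y-\omega_\beta(x)J_\gamma y$ for all cyclic permutations $(\alpha,\beta,\gamma)$ of $(1,2,3)$. Curvature: $R(x,y)z=[\nabla_x,\nabla_y]z-\nabla_{[x,y]}z$, $R(x,y,z,w)=g(R(x,y)z,w)$. Ricci tensor: $\rho(y,z)=g^{ij}R(e_i,y,z,e_j)$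 for a basis $\{e_i\}$ of the tangent space. Einstein means that $\rho=\lambda g$, $\lambda\in\mathbb{R}$.
   Formalization: Einstein is stated with one real constant λ on each connected component of M (exactly ρ = λg when M is connected); with a single λ the claim fails for a disjoint union of a non-Ricci-flat example and a copy with rescaled metric g. *)

(* Defs.v *)
From HB Require Import structures.
From mathcomp Require Import all_boot all_order all_algebra.
From mathcomp Require Import all_classical all_reals all_analysis.

Set Implicit Arguments.
Unset Strict Implicit.
Unset Printing Implicit Defensive.

Import Order.TTheory GRing.Theory Num.Theory.
Import numFieldNormedType.Exports.

Local Open Scope classical_set_scope.
Local Open Scope ring_scope.

Section Calculus.
Context {R : realType} {m : nat}.
Implicit Types (U : set 'cV[R]_m) (f : 'cV[R]_m -> R).

(* Meaningful for open U: all iterated partial derivatives of order <= k exist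
   and are continuous on U. *)
Fixpoint Ck_on (k : nat) U f : Prop :=
  {in U, continuous f} /\
  if k is k'.+1 then
    forall a : 'I_m, {in U, forall u, derivable f u (delta_mx a 0)} /\
                     Ck_on k' U (fun u => 'D_(delta_mx a 0) f u)
  else True.

Definition smooth_on U f : Prop := forall k, Ck_on k U f.

End Calculus.

(* A manifold is a Hausdorff second countable space with a smooth atlas, not
   required to be maximal and not required to be connected.  The values of
   [phi i] outside [dom i], and of [psi i] outside [phi i @` dom i], are
   irrelevant. *)
Record smooth_manifold (R : realType) (m : nat) := SmoothManifold {
  point :> topologicalType ;
  point_hausdorff : hausdorff_space point ;
  point_second_countable : @second_countable point ;
  chart : Type ;
  dom : chart -> set point ;
  phi : chart -> point -> 'cV[R]_m ;
  psi : chart -> 'cV[R]_m -> point ;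
  dom_open : forall i, open (dom i) ;
  dom_cover : forall p, exists i, dom i p ;
  phi_open : forall i, open (phi i @` dom i) ;
  phiK : forall i, {in dom i, cancel (phi i) (psi i)} ;
  phi_continuous : forall i, {in dom i, continuous (phi i)} ;
  psi_continuous : forall i, {in phi i @` dom i, continuous (psi i)} ;
  transition_smooth : forall i j (a : 'I_m),
    smooth_on (phi i @` (dom i `&` dom j)) (fun u => phi j (psi i u) a 0)
}.

(* Geometric objects are given by their components in the charts of the atlas,
   as functions on the manifold; the components in chart [i] matter only on
   [dom i].  A tangent vector is the column of its components, a covector the
   row of its components. *)
Section Fields.
Context {R : realType} {m : nat} (M : smooth_manifold R m).
Local Notation I := (chart M).

Definition covector_family := I -> M -> 'rV[R]_m.
Definition matrix_family := I -> M -> 'M[R]_m.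
Implicit Types (i j : I) (p q : M) (f : M -> R) (X Y Z : M -> 'cV[R]_m).
Implicit Types (V W : set M) (g J : matrix_family) (w : covector_family).

Definition smooth_in i W f : Prop := smooth_on (phi i @` W) (f \o psi i).

Definition partial i (a : 'I_m) f p : R :=
  'D_(delta_mx a 0) (f \o psi i) (phi i p).

(* Jacobian of the change from chart [i] to chart [j]: the components of a
   tangent vector at [p] obey v_j = jac i j p *m v_i. *)
Definition jac i j p : 'M[R]_m :=
  \matrix_(a, b) partial i b (fun q => phi j q a 0) p.

Definition one_form V w : Prop :=
  (forall i b, smooth_in i (V `&` dom i) (fun p => w i p 0 b)) /\
  (forall i j p, V p -> dom i p -> dom j p -> w i p = w j p *m jac i j p).

Definition tensor11 J : Prop :=
  (forall i a b, smooth_in i (dom i) (fun p => J i p a b)) /\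
  (forall i j p, dom i p -> dom j p ->
     jac i j p *m J i p = J j p *m jac i j p).

Definition tensor02 g : Prop :=
  (forall i a b, smooth_in i (dom i) (fun p => g i p a b)) /\
  (forall i j p, dom i p -> dom j p ->
     g i p = (jac i j p)^T *m g j p *m jac i j p).

Definition ev (w : 'rV[R]_m) (x : 'cV[R]_m) : R := (w *m x) 0 0.
Definition bil (G : 'M[R]_m) (x y : 'cV[R]_m) : R := (x^T *m G *m y) 0 0.

(* [X] is the column of components, in chart [i], of a smooth vector field on
   the open set [W]. *)
Definition vector_field i W X : Prop :=
  [/\ open W, W `<=` dom i & forall a, smooth_in i W (fun p => X p a 0)].

Definition lie_derivative i X f p : R := \sum_a X p a 0 * partial i a f p.

Definition bracket i X Y p : 'cV[R]_m :=
  \col_c (lie_derivative i X (fun q => Y q c 0) p -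
          lie_derivative i Y (fun q => X q c 0) p).

(* Connection coefficients: in chart [i] the covariant derivative of the
   coordinate field e_b along e_a is the vector [Gamma i p a b]. *)
Definition christoffel_family := I -> M -> 'I_m -> 'I_m -> 'cV[R]_m.
Implicit Type Gamma : christoffel_family.

Definition nabla Gamma i X Y p : 'cV[R]_m :=
  (\col_c lie_derivative i X (fun q => Y q c 0) p) +
  \sum_a \sum_b (X p a 0 * Y p b 0) *: Gamma i p a b.

Definition affine_connection Gamma : Prop :=
  (forall i a b c, smooth_in i (dom i) (fun p => Gamma i p a b c 0)) /\
  (forall i j W X Y, W `<=` dom j -> vector_field i W X -> vector_field i W Y ->
     forall p, W p ->
     nabla Gamma j (fun q => jac i j q *m X q) (fun q => jac i j q *m Y q) p =
     jac i j p *m nabla Gamma i X Y p).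

Definition nabla_endo Gamma J i X Y p : 'cV[R]_m :=
  nabla Gamma i X (fun q => J i q *m Y q) p - J i p *m nabla Gamma i X Y p.

Definition pseudo_riemannian_metric g : Prop :=
  [/\ tensor02 g,
      (forall i p, dom i p -> (g i p)^T = g i p) &
      (forall i p, dom i p -> g i p \in unitmx)].

Definition levi_civita g Gamma : Prop :=
  [/\ affine_connection Gamma,
      (forall i W X Y, vector_field i W X -> vector_field i W Y ->
         forall p, W p ->
         nabla Gamma i X Y p - nabla Gamma i Y X p = bracket i X Y p) &
      (forall i W X Y Z, vector_field i W X -> vector_field i W Y ->
         vector_field i W Z -> forall p, W p ->
         lie_derivative i X (fun q => bil (g i q) (Y q) (Z q)) p =
         bil (g i p) (nabla Gamma i X Y p) (Z p) +
         bil (g i p) (Y p) (nabla Gamma i X Z p))].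

Definition curvature_op Gamma i X Y Z p : 'cV[R]_m :=
  nabla Gamma i X (nabla Gamma i Y Z) p -
  nabla Gamma i Y (nabla Gamma i X Z) p -
  nabla Gamma i (bracket i X Y) Z p.

(* Tangent vectors are extended by constant components in chart [i]; the
   choice of extension is immaterial since the curvature is a tensor. *)
Definition curvature Gamma i p (x y z : 'cV[R]_m) : 'cV[R]_m :=
  curvature_op Gamma i (fun=> x) (fun=> y) (fun=> z) p.

Definition curvature4 g Gamma i p (x y z t : 'cV[R]_m) : R :=
  bil (g i p) (curvature Gamma i p x y z) t.

Definition ricci g Gamma i p (y z : 'cV[R]_m) : R :=
  \sum_a \sum_b invmx (g i p) a b *
    curvature4 g Gamma i p (delta_mx a 0) y z (delta_mx b 0).

Definition einstein_on (A : set M) g Gamma : Prop :=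
  exists lambda : R, forall i p, A p -> dom i p ->
    forall y z, ricci g Gamma i p y z = lambda * bil (g i p) y z.

(* On a connected manifold this is rho = lambda g with one real constant; in
   general the constant may depend on the connected component. *)
Definition Einstein g Gamma : Prop :=
  forall p, einstein_on (connected_component [set: M] p) g Gamma.

End Fields.

(* The indices 1, 2, 3 are the elements 0, 1, 2 of 'I_3; the cyclic
   permutations of (1, 2, 3) are (al, ordS al, ordS (ordS al)). *)
Section Quaternionic.
Context {R : realType} {n : nat} (M : smooth_manifold R (4 * n)).
Implicit Types (J gs : 'I_3 -> matrix_family M) (g : matrix_family M).
Implicit Type Gamma : christoffel_family M.

Definition eps (al : 'I_3) : R := if al == ord0 then 1 else -1.

Definition almost_hypercomplex J : Prop :=
  (forall al, tensor11 (J al)) /\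
  (forall al i p, dom i p ->
     let be := ordS al in let ga := ordS be in
     [/\ J al i p *m J al i p = - 1%:M,
         J al i p = J be i p *m J ga i p &
         J al i p = - (J ga i p *m J be i p)]).

Definition neutral_signature g : Prop :=
  forall i p, dom i p -> exists P : 'M[R]_(4 * n), P \in unitmx /\
    P^T *m g i p *m P =
    diag_mx (\row_(a < 4 * n) (if (a < 2 * n)%N then 1 else -1)).

(* The structure G = (g, g_1, g_2, g_3), with gs al = g_al. *)
Record NH_metric_structure J g gs : Prop := NHMetricStructure {
  NH_metric : pseudo_riemannian_metric g ;
  NH_neutral : neutral_signature g ;
  NH_compat : forall al i p, dom i p -> forall x y,
    bil (g i p) x y = eps al * bil (g i p) (J al i p *m x) (J al i p *m y) ;
  NH_assoc : forall al i p, dom i p -> forall x y,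
    bil (gs al i p) x y = bil (g i p) (J al i p *m x) y ;
  NH_assoc_eps : forall al i p, dom i p -> forall x y,
    bil (gs al i p) x y = - eps al * bil (g i p) x (J al i p *m y)
}.

Definition quaternionic_kahler J Gamma : Prop :=
  forall p0 : M, exists (V : set M) (om : 'I_3 -> covector_family M),
    [/\ open V, V p0, (forall al, one_form V (om al)) &
     forall al i W X Y, W `<=` V -> vector_field i W X -> vector_field i W Y ->
     forall p, W p ->
     let be := ordS al in let ga := ordS be in
     nabla_endo Gamma (J al) i X Y p =
     ev (om ga i p) (X p) *: (J be i p *m Y p) -
     ev (om be i p) (X p) *: (J ga i p *m Y p)].

End Quaternionic.

(* Main.v *)
From HB Require Import structures.
Require Import Defs.
From mathcomp Require Import all_boot all_order all_algebra.
From mathcomp Require Import all_classical all_reals all_analysis.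
From mathcomp Require Import ring lra.

Set Implicit Arguments.
Unset Strict Implicit.
Unset Printing Implicit Defensive.

Import Order.TTheory GRing.Theory Num.Theory.
Import numFieldNormedType.Exports.

Local Open Scope classical_set_scope.
Local Open Scope ring_scope.

Local Notation "''u_' a" := (delta_mx a 0) (at level 8, a at level 2).

(** Write m = 4n for the dimension and Omega(x, y) = g(x, J_1 y).

    The compatibility with g makes J_1 skew and J_2, J_3 self-adjoint.  The
    covariant derivative of J_1 is therefore skew, while the quaternionic
    Kaehler condition says that it equals omega_3 J_2 - omega_2 J_3, which is
    self-adjoint.  Hence omega_2 = omega_3 = 0 ([NH_connection_reduces]): J_1
    is parallel, and with omega = omega_1 the other two derivatives are
    omega J_3 and - omega J_2.  Differentiating once more, the curvature
    commutes with J_1 and satisfies [R(x, y), J_2] = A(x, y) J_3 with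
    A = d omega ([curvature_identity]).

    At a single point these commutation rules, the skewness of R and the first
    Bianchi identity are enough to find lambda with rho = lambda g, and they
    also give m A = 4 lambda Omega ([pointwise_einstein]).  This is where
    m <> 4 is needed.

    That lambda is constant follows from the second relation without the
    second Bianchi identity.  Omega is parallel, hence closed; A is exact.  So
    d lambda /\ Omega = 0, and since Omega is nondegenerate and m > 2 this
    forces d lambda = 0 ([chart_einstein_locally_constant]).  The same relation
    makes lambda independent of the chart, because A and Omega are both
    2-forms and Omega is not zero ([einstein_at_chart_change]).  A locally
    constant function is constant on every connected component.

    The analysis behind this is the symmetry of second derivatives, used for
    the curvature identities and for d d = 0, and the chain rule, used for the
    naturality of d.  Since smoothness is expressed by iterated partial
    derivatives, both are derived from the mean value theorem on segments. *)

(** * Bilinear forms *)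

Section Bilinear.
Context {R : realType} {m : nat}.
Implicit Types (G B : 'M[R]_m) (x y z : 'cV[R]_m).

Lemma bilDl G x y z : bil G (x + y) z = bil G x z + bil G y z.
Proof. by rewrite /bil raddfD/= !mulmxDl mxE. Qed.

Lemma bilNl G x y : bil G (- x) y = - bil G x y.
Proof. by rewrite /bil raddfN/= !mulNmx mxE. Qed.

Lemma bilNr G x y : bil G x (- y) = - bil G x y.
Proof. by rewrite /bil mulmxN mxE. Qed.

Lemma bilZl G (k : R) x y : bil G (k *: x) y = k * bil G x y.
Proof. by rewrite /bil linearZ/= -!scalemxAl mxE. Qed.

Lemma bilC G x y : bil G x y = bil G^T y x.
Proof.
rewrite /bil -[in LHS](trmxK (x^T *m G *m y)) mxE.
by rewrite !trmx_mul trmxK mulmxA.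
Qed.

Lemma bil_mull G B x y : bil G (B *m x) y = bil (B^T *m G) x y.
Proof. by rewrite /bil trmx_mul !mulmxA. Qed.
Lemma bil_mulr G B x y : bil G x (B *m y) = bil (G *m B) x y.
Proof. by rewrite /bil !mulmxA. Qed.

Lemma bil_delta G a b : bil G (delta_mx a 0) (delta_mx b 0) = G a b.
Proof. by rewrite /bil trmx_delta -rowE -colE !mxE. Qed.

Lemma bil_inj G B : (forall x y, bil G x y = bil B x y) -> G = B.
Proof. by move=> h; apply/matrixP => a b; rewrite -!bil_delta. Qed.

Lemma bil_nondegenerate G x z : G \in unitmx ->
  (forall y, bil G x y = bil G z y) -> x = z.
Proof.
move=> Gu h; apply: trmx_inj; apply: (can_inj (mulmxK Gu)).
apply/rowP => b; have := h (delta_mx b 0).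
by rewrite /bil -!colE !mxE.
Qed.

Lemma mulmx_delta_inj (B C : 'M[R]_m) :
  (forall b, B *m (delta_mx b 0 : 'cV[R]_m) = C *m delta_mx b 0) -> B = C.
Proof.
move=> h; apply/matrixP => a b; have /colP/(_ a) := h b.
by rewrite -!colE !mxE.
Qed.

Lemma mulmx_inj (B C : 'M[R]_m) : (forall x : 'cV[R]_m, B *m x = C *m x) -> B = C.
Proof. by move=> h; apply: mulmx_delta_inj. Qed.

End Bilinear.

Section PairSymmetry.
Context {R : realType} {V : Type} (Q : V -> V -> V -> V -> R).
Hypotheses (skew12 : forall x y z w, Q x y z w = - Q y x z w)
  (skew34 : forall x y z w, Q x y z w = - Q x y w z)
  (bianchi : forall x y z w, Q x y z w + Q y z x w + Q z x y w = 0).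

(** The octahedron argument: add the Bianchi identities for the four cyclic
    arrangements of the arguments; skewness cancels all but two terms. *)
Lemma pair_symmetry x y z w : Q x y z w = Q z w x y.
Proof.
have := bianchi x y z w; have := bianchi y z w x.
have := bianchi z w x y; have := bianchi w x y z.
have := skew12 x y z w; have := skew34 x y z w.
have := skew34 y z x w; have := skew34 z x y w; have := skew12 z x w y.
have := skew12 y z w x; have := skew34 z w y x; have := skew34 w y z x.
have := skew12 w y z x; have := skew12 w y x z.
have := skew34 w x z y; have := skew34 y w x z; have := skew34 w x y z.
have := skew34 x y w z; have := skew34 x z w y; have := skew12 x z w y.
have := skew34 z w x y; have := skew12 w x z y; have := skew34 z x w y.
have := skew12 y w x z; have := skew12 y w z x; have := skew34 y w z x.
lra.
Qed.

End PairSymmetry.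

(** * Algebra at one point *)

Section NHAlgebra.
Context {R : realType} {m : nat}.

Record NH_algebra (G J1 J2 J3 : 'M[R]_m) : Prop := NHAlgebra {
  NH_sym : G^T = G ;
  NH_unit : G \in unitmx ;
  NH_J11 : J1 *m J1 = - 1%:M ;
  NH_J22 : J2 *m J2 = - 1%:M ;
  NH_J33 : J3 *m J3 = - 1%:M ;
  NH_J12 : J1 *m J2 = J3 ;
  NH_J23 : J2 *m J3 = J1 ;
  NH_J31 : J3 *m J1 = J2 ;
  NH_J21 : J2 *m J1 = - J3 ;
  NH_J32 : J3 *m J2 = - J1 ;
  NH_J13 : J1 *m J3 = - J2 ;
  NH_adj1 : J1^T *m G = - (G *m J1) ;
  NH_adj2 : J2^T *m G = G *m J2 ;
  NH_adj3 : J3^T *m G = G *m J3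
}.

End NHAlgebra.

(** [Rop x y] is the curvature operator and [K y z] the matrix of the map that
    sends x to R(x, y) z, so that the Ricci tensor is the trace of [K]; the
    2-form of [B] is the exterior derivative of the connection form. *)
Section PointwiseEinstein.
Context {R : realType} {m : nat}.
Implicit Types x y z w : 'cV[R]_m.
Variables (G J1 J2 J3 B : 'M[R]_m) (Rop K : 'cV[R]_m -> 'cV[R]_m -> 'M[R]_m).
Hypotheses (m0 : (0 < m)%N) (m4 : m <> 4%N) (NH : NH_algebra G J1 J2 J3)
  (RopC : forall x y, Rop x y = - Rop y x)
  (RK : forall x y z, Rop x y *m z = K y z *m x)
  (bianchi : forall x y z, Rop x y *m z + Rop y z *m x + Rop z x *m y = 0)
  (Rskew : forall x y, (Rop x y)^T *m G = - (G *m Rop x y))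
  (RJ1 : forall x y, Rop x y *m J1 = J1 *m Rop x y)
  (RJ2 : forall x y, Rop x y *m J2 = J2 *m Rop x y + bil B x y *: J3).

Local Notation g := (bil G).
Local Notation A := (bil B).
Let rho y z := \tr (K y z).

Let Gsym := NH_sym NH.
Let Gu := NH_unit NH.
Let J1J1 := NH_J11 NH.
Let J2J2 := NH_J22 NH.
Let J3J3 := NH_J33 NH.
Let J12 := NH_J12 NH.
Let J21 := NH_J21 NH.
Let J32 := NH_J32 NH.
Let J13 := NH_J13 NH.
Let GJ1 := NH_adj1 NH.
Let GJ2 := NH_adj2 NH.
Let GJ3 := NH_adj3 NH.

Let gC x y : g x y = g y x. Proof. by rewrite bilC Gsym. Qed.
Let gJ1 x y : g (J1 *m x) y = - g x (J1 *m y).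
Proof. by rewrite bil_mull GJ1 bil_mulr /bil mulmxN mulNmx mxE. Qed.
Let gJ2 x y : g (J2 *m x) y = g x (J2 *m y).
Proof. by rewrite bil_mull GJ2 bil_mulr. Qed.

Let gR x y z w : g (Rop x y *m z) w = g (Rop z w *m x) y.
Proof.
apply: (@pair_symmetry _ _ (fun x y z w => g (Rop x y *m z) w)) => {x y z w} x y z w.
- by rewrite RopC mulNmx bilNl.
- by rewrite bil_mull Rskew [in RHS]gC bil_mulr /bil mulmxN mulNmx mxE.
- by rewrite -!bilDl bianchi /bil trmx0 !mul0mx mxE.
Qed.

(** J_1 commutes with every R(z, w) and is a g-isometry; pair symmetry turns
    this into invariance in the first two arguments. *)
Let RJ1J1 x y : Rop (J1 *m x) (J1 *m y) = Rop x y.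
Proof.
apply: mulmx_inj => z; apply: (bil_nondegenerate Gu) => w.
rewrite gR [in RHS]gR mulmxA RJ1 -mulmxA gJ1 mulmxA J1J1.
by rewrite mulNmx mul1mx bilNr opprK.
Qed.

(** The first Bianchi identity, with one argument left free. *)
Let K_antisym x z : K x z - K z x = - Rop x z.
Proof.
apply: mulmx_inj => y; rewrite mulmxBl -!RK mulNmx.
have /eqP := bianchi y x z; rewrite [Rop z y]RopC mulNmx.
by rewrite addrAC addr_eq0 => /eqP.
Qed.

Let trRop x y : \tr (Rop x y) = 0.
Proof.
have : \tr (Rop x y) = - \tr (Rop x y).
  rewrite -[LHS]mxtrace_tr -[in LHS](mulmxK Gu (Rop x y)^T) Rskew mulNmx raddfN/=.
  by rewrite mxtrace_mulC mulmxA mulVmx// mul1mx.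
by move=> /eqP; rewrite -addr_eq0 -mulr2n mulrn_eq0 => /eqP.
Qed.

Let rhoC x y : rho x y = rho y x.
Proof.
by apply/eqP; rewrite -subr_eq0 /rho -raddfB/= K_antisym raddfN/= trRop oppr0.
Qed.

Let RopNl x y : Rop (- x) y = - Rop x y.
Proof. by apply: mulmx_inj => z; rewrite mulNmx !RK mulmxN. Qed.

Let rhoNl x y : rho (- x) y = - rho x y.
Proof.
rewrite /rho -raddfN/=; congr (\tr _); apply: mulmx_inj => z.
by rewrite mulNmx -!RK [Rop z (- x)]RopC RopNl opprK [in RHS]RopC mulNmx opprK.
Qed.

Let rhoNr x y : rho x (- y) = - rho x y.
Proof. by rewrite rhoC rhoNl rhoC. Qed.

Let rhoJ1J1 x y : rho (J1 *m x) (J1 *m y) = rho x y.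
Proof.
rewrite /rho (_ : K _ _ = - (J1 *m K x y *m J1)).
  by rewrite raddfN/= mxtrace_mulC mulmxA J1J1 mulNmx mul1mx raddfN/= opprK.
apply: mulmx_inj => z.
have RJ : Rop z (J1 *m x) = - Rop (J1 *m z) x.
  by rewrite -(RJ1J1 (J1 *m z)) mulmxA J1J1 mulNmx mul1mx RopNl opprK.
rewrite -RK mulmxA RJ1 RJ mulmxN !mulNmx -!mulmxA; congr (- (J1 *m _)).
by rewrite RK.
Qed.

Let rhoJ1 x y : rho (J1 *m x) y = - rho x (J1 *m y).
Proof.
by rewrite -[in RHS]rhoJ1J1 mulmxA J1J1 mulNmx mul1mx rhoNr opprK.
Qed.

Let K_J1 x y : K x (J1 *m y) = J1 *m K x y.
Proof. by apply: mulmx_inj => z; rewrite -RK mulmxA RJ1 -!mulmxA RK. Qed.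

(** Trace of the Bianchi identity composed with J_1. *)
Let trJ1R x y : \tr (J1 *m Rop x y) = - 2 * rho x (J1 *m y).
Proof.
rewrite (_ : J1 *m Rop x y = K y (J1 *m x) - K x (J1 *m y)).
  rewrite raddfB/= -/(rho _ _) -/(rho _ _) rhoC rhoJ1; ring.
by rewrite !K_J1 -mulmxBr -opprB K_antisym opprK.
Qed.

(** Conjugation by J_2 reverses J_1, so only the component of R(x, y) along
    J_1, which is A(x, y) / 2, contributes to this trace. *)
Let trJ1R' x y : 2 * \tr (J1 *m Rop x y) = - (m%:R * A x y).
Proof.
have E : J1 *m Rop x y = - (J1 *m J2 *m Rop x y *m J2) - A x y *: 1%:M.
  rewrite -!mulmxA RJ2 !mulmxDr !mulmxA -(mulmxA J1) J2J2 mulmxN mulmx1 mulNmx.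
  rewrite -!scalemxAr J12 J3J3 scalerN opprD !opprK -addrA subrr addr0 //.
have T : \tr (J1 *m J2 *m Rop x y *m J2) = \tr (J1 *m Rop x y).
  by rewrite mxtrace_mulC !mulmxA J21 mulNmx J32 opprK.
have := congr1 mxtrace E.
rewrite raddfB/= raddfN/= T mxtraceZ mxtrace1 => /eqP.
rewrite -subr_eq0 => /eqP h; lra.
Qed.

Let rhoA x y : 4 * rho x (J1 *m y) = m%:R * A x y.
Proof. have := trJ1R' x y; rewrite trJ1R => h; lra. Qed.

Let Arho x y : m%:R * A x y = - 4 * rho (J1 *m x) y.
Proof. rewrite -rhoA rhoJ1; ring. Qed.

(** The commutator rule for J_2 traced over x; its right-hand side becomes a
    matrix of rank one, whose trace is a value of A. *)
Let rho_J2r y z : rho y (J2 *m z) = \tr (J2 *m K y z) + A (J3 *m z) y.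
Proof.
rewrite /rho (_ : K y (J2 *m z) = J2 *m K y z + (J3 *m z) *m (B *m y)^T).
  rewrite raddfD/= [X in _ + X]mxtrace_mulC; congr (_ + _).
  by rewrite /mxtrace big_ord1 [in RHS]bilC /bil trmx_mul mulmxA.
apply: mulmx_inj => x; rewrite -RK mulmxA RJ2 !mulmxDl -!mulmxA RK; congr (_ + _).
rewrite -scalemxAl.
have -> : (B *m y)^T *m x = (A x y)%:M.
  by rewrite [LHS]mx11_scalar [in RHS]bilC /bil trmx_mul.
by rewrite mul_mx_scalar -scalemxAr.
Qed.

(** The commutator rule for J_2, moved by pair symmetry to the first two
    arguments of the curvature. *)
Let R_J2_pair x y z w : g (Rop (J2 *m x) y *m z) w - g (Rop x (J2 *m y) *m z) w
  = A z w * g (J3 *m x) y.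
Proof.
rewrite gR [X in _ - X]gR mulmxA RJ2 mulmxDl bilDl -mulmxA gJ2.
by rewrite addrAC subrr add0r -scalemxAl bilZl.
Qed.

Let R_J2 x y z w : g (Rop x y *m (J2 *m z)) w - g (Rop x y *m z) (J2 *m w)
  = A x y * g (J3 *m z) w.
Proof.
rewrite mulmxA RJ2 mulmxDl bilDl -mulmxA gJ2.
by rewrite addrAC subrr add0r -scalemxAl bilZl.
Qed.

(** The trace over x of [R_J2_pair]. *)
Let rho_J2l y z : \tr (J2 *m K y z) - rho (J2 *m y) z = A z (J3 *m y).
Proof.
have E : K y z *m J2 - K (J2 *m y) z =
    (invmx G *m B^T *m z) *m (y^T *m G *m J3).
  apply: mulmx_inj => x; apply: (bil_nondegenerate Gu) => w.
  rewrite mulmxBl bilDl bilNl -(mulmxA (K y z)) -(RK (J2 *m x)) -(RK x) R_J2_pair.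
  have -> : invmx G *m B^T *m z *m (y^T *m G *m J3) *m x =
      g (J3 *m x) y *: (invmx G *m B^T *m z).
    rewrite -mulmxA [X in _ *m X]mx11_scalar mul_mx_scalar; congr (_ *: _).
    by rewrite gC /bil -!mulmxA.
  rewrite bilZl mulrC; congr (_ * _).
  by rewrite -mulmxA bil_mull trmx_inv Gsym mulVmx// /bil mulmx1 trmx_mul trmxK.
rewrite mxtrace_mulC /rho -raddfB/= E mxtrace_mulC /mxtrace big_ord1.
rewrite [RHS]bilC /bil trmx_mul.
rewrite !mulmxA -(mulmxA y^T) -GJ3 mulmxA.
by rewrite -(mulmxA (y^T *m J3^T) G) mulmxV// mulmx1.
Qed.

(** Adding the two traces and replacing A by rho leaves
    (m - 4) (rho(y, J_2 z) - rho(J_2 y, z)) = 0. *)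
Let rho_J2 y z : rho (J2 *m y) z = rho y (J2 *m z).
Proof.
have H : rho y (J2 *m z) - rho (J2 *m y) z = A (J3 *m z) y + A z (J3 *m y).
  by rewrite rho_J2r -(rho_J2l y z); ring.
have E1 : m%:R * A (J3 *m z) y = 4 * rho (J2 *m z) y.
  by rewrite Arho mulmxA J13 mulNmx rhoNl; ring.
have E2 : m%:R * A z (J3 *m y) = - 4 * rho z (J2 *m y).
  by rewrite -rhoA mulmxA J13 mulNmx rhoNr; ring.
have m4' : (m%:R - 4 : R) != 0.
  by rewrite subr_eq0 (eqr_nat R m 4); apply/eqP.
apply/esym/eqP; rewrite -subr_eq0; apply/eqP/(mulfI m4').
rewrite mulr0; have h := congr1 (fun t => m%:R * t) H.
rewrite /= (mulrDr _ (A _ _)) E1 E2 (rhoC (J2 *m z)) (rhoC z) in h.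
by rewrite mulrBl h; ring.
Qed.

Let rho_J3 y z : rho (J3 *m y) z = rho y (J3 *m z).
Proof.
by rewrite -{1}J12 -mulmxA rhoJ1 rho_J2 mulmxA J21 mulNmx rhoNr opprK.
Qed.

Let F x y := A (J2 *m x) y - A x (J2 *m y).

(** Apply the commutator rule for J_2 in both pairs of arguments of the
    curvature, in either order: the same quantity is a multiple of g(J_3 _, _) in
    each pair.  This is what forces rho to be proportional to g. *)
Let F_prop x y z w : g (J3 *m z) w * F x y = g (J3 *m x) y * F z w.
Proof.
rewrite /F !mulrBr.
have a := R_J2 (J2 *m x) y z w; have b := R_J2 x (J2 *m y) z w.
have c := R_J2_pair x y (J2 *m z) w; have d := R_J2_pair x y z (J2 *m w).
rewrite ![g (J3 *m z) w * _]mulrC ![g (J3 *m x) y * _]mulrC -a -b -c -d; ring.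
Qed.

Let F_rho x y : m%:R * F x y = - 8 * rho (J3 *m x) y.
Proof.
have a : 4 * rho (J2 *m x) (J1 *m y) = - 4 * rho (J3 *m x) y.
  by rewrite -[rho _ (J1 *m y)]opprK -rhoJ1 mulmxA J12; ring.
have b : 4 * rho x (J1 *m (J2 *m y)) = 4 * rho (J3 *m x) y.
  by rewrite mulmxA J12 rho_J3.
by rewrite /F mulrBr -!rhoA a b; ring.
Qed.

Lemma pointwise_einstein : exists lambda : R,
  (forall y z, \tr (K y z) = lambda * g y z) /\
  (forall x y, m%:R * A x y = 4 * lambda * g x (J1 *m y)).
Proof.
have [z [w zw]] : exists z w, g (J3 *m z) w != 0.
  apply: contrapT => /forallNP h.
  have J30 : J3 = 0.
    apply: mulmx_inj => z; apply: (bil_nondegenerate Gu) => w.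
    move: (h z) => /forallNP/(_ w)/negP/negPn/eqP ->.
    by rewrite mul0mx /bil trmx0 !mul0mx mxE.
  have /matrixP/(_ (Ordinal m0) (Ordinal m0)) := J3J3.
  rewrite J30 mul0mx !mxE eqxx => /eqP.
  by rewrite eq_sym oppr_eq0 oner_eq0.
exists (- (m%:R * F z w) / (8 * g (J3 *m z) w)).
have E y x : rho y x = - (m%:R * F z w) / (8 * g (J3 *m z) w) * g y x.
  have J3N : J3 *m (- (J3 *m y)) = y by rewrite mulmxN mulmxA J3J3 mulNmx mul1mx opprK.
  have := congr1 ( *%R m%:R) (F_prop (- (J3 *m y)) x z w).
  rewrite J3N [LHS]mulrCA (F_rho (- _)) J3N => h.
  have h' : g (J3 *m z) w * rho y x * 8 = - (g y x * (m%:R * F z w)).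
    by rewrite [in RHS]mulrCA -h; ring.
  apply: (mulfI zw); apply: (@mulIf _ (8 : R)); first by rewrite pnatr_eq0.
  by rewrite h'; field; rewrite zw.
split=> // x y; rewrite -rhoA E; ring.
Qed.

End PointwiseEinstein.

Section ReducedConnection.
Context {R : realType} {m : nat}.

(** [Ga] is the connection matrix in a direction, [dG] and [dJ1] the
    derivatives in that direction.  The last equation is the derivative of
    J_1^T G + G J_1 = 0; the terms in [Ga] cancel there, which leaves
    2 G (a J_2 - b J_3) = 0. *)
Lemma NH_connection_reduces (G J1 J2 J3 Ga dG dJ1 : 'M[R]_m) (a b : R) :
  (0 < m)%N -> NH_algebra G J1 J2 J3 ->
  dG = Ga^T *m G + G *m Ga ->
  dJ1 = J1 *m Ga - Ga *m J1 + (a *: J2 - b *: J3) ->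
  dJ1^T *m G + J1^T *m dG + (dG *m J1 + G *m dJ1) = 0 ->
  a = 0 /\ b = 0.
Proof.
move=> m0 NH -> ->.
have [N NE] : exists N, a *: J2 - b *: J3 = N by eexists.
rewrite NE.
have NG : N^T *m G = G *m N.
  rewrite -NE raddfB/= !linearZ/= mulmxDl -!scalemxAl mulNmx (NH_adj2 NH) (NH_adj3 NH).
  by rewrite mulmxDr -!scalemxAr mulmxN.
have JG := NH_adj1 NH.
have -> : (J1 *m Ga - Ga *m J1 + N)^T *m G + J1^T *m (Ga^T *m G + G *m Ga) +
   ((Ga^T *m G + G *m Ga) *m J1 + G *m (J1 *m Ga - Ga *m J1 + N)) = 2 *: (G *m N).
  rewrite !raddfD/= !raddfN/= !trmx_mul !(mulmxDl, mulmxDr, mulNmx, mulmxN) NG.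
  rewrite -(mulmxA Ga^T J1^T G) (mulmxA J1^T G) JG mulNmx mulmxN !mulmxA.
  move: (Ga^T *m G *m J1) (G *m J1 *m Ga) (G *m Ga *m J1) (J1^T *m Ga^T *m G) (G *m N).
  by move=> c d e f h; apply/matrixP => i j; rewrite !mxE; ring.
move=> /eqP; rewrite scaler_eq0 pnatr_eq0/= => /eqP GN0.
have : invmx (G) *m (G *m N) = 0 by rewrite GN0 mulmx0.
rewrite mulmxA mulVmx ?(NH_unit NH)// mul1mx -NE => /eqP; rewrite subr_eq0 => /eqP N0.
have E : - a *: 1%:M = b *: J1.
  by rewrite -(NH_J23 NH) scalemxAr -N0 -scalemxAr (NH_J22 NH) scalerN scaleNr.
have E2 : - a *: J1 = - b *: 1%:M.
  have := congr1 (mulmx J1) E; rewrite -!scalemxAr mulmx1 (NH_J11 NH) => ->.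
  by rewrite scalerN scaleNr.
have : (a ^+ 2 + b ^+ 2) *: (1%:M : 'M[R]_m) = 0.
  have := congr1 ( *:%R a) E; have := congr1 ( *:%R b) E2; rewrite !scalerA => H1 H2.
  have H3 : (b * - a) *: J1 = - ((a * b) *: J1) by rewrite mulrN scaleNr mulrC.
  move: H1; rewrite H3 -H2 => /eqP; rewrite -subr_eq0 -scaleNr -scalerBl => /eqP <-.
  by congr (_ *: _); ring.
move=> /matrixP/(_ (Ordinal m0) (Ordinal m0)); rewrite !mxE eqxx mulr1 => /eqP.
rewrite paddr_eq0 ?sqr_ge0// !sqrf_eq0 => /andP[/eqP -> /eqP ->]; by split.
Qed.

End ReducedConnection.

(** * Derivatives along lines *)

Section Line.
Context {R : realType} {V W : normedModType R}.
Implicit Types (f : V -> W) (u v : V).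

(** The difference quotients are literally equal, so that derivability and
    derivative transfer between a function and its restriction to a line. *)
Lemma line_growth_rate f u v (t : R) :
  (fun h : R => h^-1 *: (((fun s : R => f (u + s *: v)) \o shift t) (h *: 1) -
    f (u + t *: v))) =
  (fun h => h^-1 *: ((f \o shift (u + t *: v)) (h *: v) - f (u + t *: v))).
Proof.
apply/funext => h /=; congr (_ *: (f _ - _)).
by rewrite [h *: 1]mulr1 scalerDl addrCA.
Qed.

Lemma derive_line f u v (t : R) :
  'D_1 (fun s : R => f (u + s *: v)) t = 'D_v f (u + t *: v).
Proof. by rewrite /derive line_growth_rate. Qed.

Lemma derivable_line f u v (t : R) :
  derivable (fun s : R => f (u + s *: v)) t 1 <-> derivable f (u + t *: v) v.
Proof. by rewrite /derivable line_growth_rate. Qed.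

End Line.

Section MeanValue.
Context {R : realType} {V : normedModType R}.
Implicit Types (f : V -> R) (u v : V).

Lemma is_derive_line f u v (t : R) : derivable f (u + t *: v) v ->
  is_derive t 1 (fun s : R => f (u + s *: v)) ('D_v f (u + t *: v)).
Proof. by move=> df; split; [exact/derivable_line | exact: derive_line]. Qed.

Lemma mvt_line f u v (h : R) :
  (forall t, `|t| <= `|h| -> derivable f (u + t *: v) v) ->
  exists2 t, `|t| <= `|h| & f (u + h *: v) - f u = h * 'D_v f (u + t *: v).
Proof.
move=> df; pose F s := f (u + s *: v).
have cF (a b : R) : (forall t, t \in `[a, b] -> `|t| <= `|h|) ->
    {within `[a, b], continuous F}.
  move=> ab; apply: derivable_within_continuous => t tab.
  by have [] := is_derive_line (df t (ab t tab)).
have [h0|h0] := leP 0 h.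
- have H t : t \in `[0, h] -> `|t| <= `|h|.
    by rewrite in_itv/= => /andP[t0 th]; rewrite !ger0_norm// (le_trans t0 th).
  have [|t th e] := @MVT_segment R F (fun t => 'D_v f (u + t *: v)) 0 h h0 _ (cF _ _ H).
    by move=> t th; apply: is_derive_line; apply: df; apply: H; apply: subset_itv_oo_cc.
  exists t; first exact: H.
  by move: e; rewrite /F scale0r addr0 subr0 mulrC.
- have H t : t \in `[h, 0] -> `|t| <= `|h|.
    rewrite in_itv/= => /andP[t0 th]; rewrite !ler0_norm ?lerN2//.
    exact: le_trans t0 th.
  have [|t th e] := @MVT_segment R F (fun t => 'D_v f (u + t *: v)) h 0 (ltW h0) _ (cF _ _ H).
    by move=> t th; apply: is_derive_line; apply: df; apply: H; apply: subset_itv_oo_cc.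
  exists t; first exact: H.
  move: e; rewrite /F scale0r addr0 sub0r => e.
  by rewrite -opprB e mulrN opprK mulrC.
Qed.

(** Schwarz: by two applications of the mean value theorem the second
    difference of f over a small parallelogram, divided by h^2, is close to
    either mixed derivative. *)
Lemma mixed_derivatives f u v w :
  (\forall z \near u, derivable f z v) ->
  (\forall z \near u, derivable f z w) ->
  (\forall z \near u, derivable ('D_v f) z w) ->
  (\forall z \near u, derivable ('D_w f) z v) ->
  {for u, continuous ('D_w ('D_v f))} ->
  {for u, continuous ('D_v ('D_w f))} ->
  'D_w ('D_v f) u = 'D_v ('D_w f) u.
Proof.

have key (v' w' : V) : (\forall z \near u, derivable f z v') ->
  (\forall z \near u, derivable ('D_v' f) z w') ->
  {for u, continuous ('D_w' ('D_v' f))} -> forall e : R, 0 < e ->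
  \forall h \near (0 : R), `|f (u + h *: w' + h *: v') - f (u + h *: w') -
     (f (u + h *: v') - f u) - h * h * 'D_w' ('D_v' f) u| <= h * h * e.
  move=> d1 d2 c e e0.
  have c1 : \forall z \near u, `|'D_w' ('D_v' f) u - 'D_w' ('D_v' f) z| <= e.
    by move/cvgrPdist_le : c => /(_ e e0).
  have [d /= d0 Hd] := (nbhs_ballP u _).1 (filterI d1 (filterI d2 c1)).
  (* Steps of size less than r along v' and w' stay in the ball of radius d. *)
  pose r := d / (1 + `|v'| + `|w'|).
  have den0 : 0 < 1 + `|v'| + `|w'| by rewrite -addrA ltr_pwDl// addr_ge0.
  have r0 : 0 < r by rewrite divr_gt0.
  have near_u (s t : R) : `|s| < r -> `|t| < r -> ball u d (u + s *: v' + t *: w').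
    move=> sr tr; rewrite -ball_normE /ball_/= opprD addrA opprD addrA subrr sub0r.
    rewrite -opprD normrN (le_lt_trans (ler_normD _ _))// !normrZ.
    apply: (@le_lt_trans _ _ (r * (`|v'| + `|w'|))).
      by rewrite mulrDr lerD// ler_wpM2r// ltW.
    rewrite /r mulrAC ltr_pdivrMr// ltr_pM2l// -addrA ltrDr //.
  near=> h.
  have hr : `|h| < r by near: h; exact: (@nbhs0_lt _ R^o _ r0).
  have ltr (t : R) : `|t| <= `|h| -> `|t| < r by move=> th; exact: le_lt_trans hr.
  pose G z := f (z + h *: w') - f z.
  have dG (t : R) : `|t| <= `|h| -> is_derive (u + t *: v') v' G
      ('D_v' f (u + t *: v' + h *: w') - 'D_v' f (u + t *: v')).
    move=> th; have tr := ltr t th.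
    have := (Hd _ (near_u t h tr hr)).1; have := (Hd _ (near_u t 0 tr _)).1.
    rewrite scale0r addr0 normr0 => /(_ r0) D1 D2.
    apply: is_deriveB; last exact: derivableP.
    have E : (fun k : R => k^-1 *: ((f \o shift (u + t *: v' + h *: w')) (k *: v') -
        f (u + t *: v' + h *: w'))) =
      (fun k => k^-1 *: (((fun z => f (z + h *: w')) \o shift (u + t *: v')) (k *: v') -
        f (u + t *: v' + h *: w'))).
      by apply/funext => k /=; rewrite !addrA.
    by split; [move: D2; rewrite /derivable E | rewrite /derive E].
  have [|t th Gt] := @mvt_line G u v' h.
    by move=> t /dG [].
  have [_ Gd] := dG t th; rewrite Gd in Gt.
  have tr := ltr t th.
  have [|s sh Gs] := @mvt_line ('D_v' f) (u + t *: v') w' h.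
    by move=> s sh; have [] := (Hd _ (near_u t s tr (ltr s sh))).2.
  rewrite Gs in Gt.
  have [_ es] := (Hd _ (near_u t s tr (ltr s sh))).2.
  have -> : f (u + h *: w' + h *: v') - f (u + h *: w') - (f (u + h *: v') - f u)
      = G (u + h *: v') - G u.
    rewrite /G [u + h *: w' + _]addrAC; ring.
  rewrite Gt mulrA -mulrBr normrM -expr2 (ger0_norm (sqr_ge0 h)).
  by apply: ler_wpM2l; [exact: sqr_ge0 | rewrite distrC; exact: es].
move=> dv dw dvw dwv cvw cwv.
apply/eqP; rewrite -subr_eq0 -normr_le0; apply/ler_addgt0Pr => e e0; rewrite add0r.
have e2 : 0 < e / 2 by rewrite divr_gt0.
have [d /= d0 Hd] := (nbhs_ballP (0 : R) _).1
  (filterI (key v w dv dvw cvw _ e2) (key w v dw dwv cwv _ e2)).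
pose h := d / 2.
have h0 : 0 < h by rewrite divr_gt0.
have hd : ball (0 : R) d h.
  rewrite -ball_normE /ball_/= sub0r normrN gtr0_norm// /h ltr_pdivrMr//.
  by rewrite ltr_pMr// ltr1n.
have [H1 H2] := Hd _ hd.
move: H1 H2; rewrite (addrAC u (h *: w)).
set A := 'D_w _ u; set B := 'D_v _ u.
set a := f (u + h *: v + h *: w); set b := f (u + h *: v); set c := f (u + h *: w).
move=> H1 H2.
have hh : 0 < h * h by rewrite mulr_gt0.
rewrite -(ler_pM2l hh).
have -> : h * h * `|A - B| = `|h * h * (A - B)|.
  by rewrite normrM (gtr0_norm hh).
have -> : h * h * (A - B) = (a - b - (c - f u) - h * h * B) - (a - c - (b - f u) - h * h * A).
  ring.
rewrite (le_trans (ler_normB _ _))// [h * h * e](_ : _ = h * h * (e / 2) + h * h * (e / 2)).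
  by apply: lerD; [exact: H2 | exact: H1].
by rewrite -mulrDr -splitr.
Unshelve. all: by end_near. Qed.

End MeanValue.

(** * Matrix-valued functions *)

Section MatrixDerivative.
Context {R : realType} {V : normedModType R}.

Lemma derive_mxE p q (F : V -> 'M[R]_(p, q)) u x i j : derivable F u x ->
  ('D_x F u) i j = 'D_x (fun v => F v i j) u.
Proof. by move=> dF; rewrite derive_mx// mxE. Qed.

Lemma is_derive_mulmx p q r (F : V -> 'M[R]_(p, q)) (H : V -> 'M[R]_(q, r)) u x dF dH :
  is_derive u x F dF -> is_derive u x H dH ->
  is_derive u x (fun v => F v *m H v) (dF *m H u + F u *m dH).
Proof.
move=> [eF <-] [eH <-].
have eFij := (derivable_mxP F u x).1 eF; have eHij := (derivable_mxP H u x).1 eH.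
have D i k : is_derive u x (fun v => (F v *m H v) i k)
    (('D_x F u *m H u + F u *m 'D_x H u) i k).
  have -> : (fun v => (F v *m H v) i k) = \sum_j ((fun v => F v i j) * (fun v => H v j k)).
    by apply/funext => v; rewrite mxE fct_sumE.
  rewrite !mxE -big_split/=; apply: is_derive_sum => j.
  have [dFH FHE] := is_deriveM (derivableP (eFij i j)) (derivableP (eHij j k)).
  split=> //; rewrite FHE (derive_mxE i j eF) (derive_mxE j k eH) addrC.
  by congr (_ + _); exact: mulrC.
have DD : derivable (fun v => F v *m H v) u x.
  by apply/derivable_mxP => i k; case: (D i k).
by split => //; apply/matrixP => i k; rewrite derive_mxE//; case: (D i k).
Qed.

Lemma is_derive_scalemx p q (h : V -> R) (F : V -> 'M[R]_(p, q)) u x dh dF :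
  is_derive u x h dh -> is_derive u x F dF ->
  is_derive u x (fun v => h v *: F v) (dh *: F u + h u *: dF).
Proof.
move=> [eh <-] [eF <-]; have eFij := (derivable_mxP F u x).1 eF.
have D i k : is_derive u x (fun v => (h v *: F v) i k)
    (('D_x h u *: F u + h u *: 'D_x F u) i k).
  have -> : (fun v => (h v *: F v) i k) = h * (fun v => F v i k).
    by apply/funext => v; rewrite mxE.
  have [dhF hFE] := is_deriveM (derivableP eh) (derivableP (eFij i k)).
  split=> //; rewrite hFE !mxE (derive_mxE i k eF) addrC; congr (_ + _); exact: mulrC.
have DD : derivable (fun v => h v *: F v) u x.
  by apply/derivable_mxP => i k; case: (D i k).
by split => //; apply/matrixP => i k; rewrite derive_mxE//; case: (D i k).
Qed.

Lemma is_derive_trmx p q (F : V -> 'M[R]_(p, q)) u x dF :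
  is_derive u x F dF -> is_derive u x (fun v => (F v)^T) dF^T.
Proof.
move=> [eF <-]; have eFij := (derivable_mxP F u x).1 eF.
have DD : derivable (fun v => (F v)^T) u x.
  apply/derivable_mxP => i k.
  by rewrite [X in derivable X _ _](_ : _ = fun v => F v k i)//; apply/funext => v; rewrite mxE.
split => //; apply/matrixP => i k; rewrite mxE !derive_mxE//.
by congr ('D_x _ u); apply/funext => v; rewrite mxE.
Qed.

End MatrixDerivative.

(** * Partial derivatives *)

Section Coord.
Context {R : realType} {m : nat}.
Implicit Types (f : 'cV[R]_m -> R) (u v x z : 'cV[R]_m).

Lemma norm_le_coord x z : (forall i, `|x i 0| <= `|z i 0|) -> `|x| <= `|z|.
Proof.
move=> h; rewrite /Num.Def.normr/= !mx_normrE; apply: bigmax_le.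
  by rewrite bigmax_ge_id.
move=> [i j] _ /=; rewrite (ord1 j); apply: le_trans (h i) _.
exact: (@le_bigmax _ _ _ 0 (fun ij : 'I_m * 'I_1 => `|z ij.1 ij.2|) (i, 0)).
Qed.

Lemma coord_le_norm x i : `|x i 0| <= `|x|.
Proof.
rewrite [leRHS]/Num.Def.normr/= mx_normrE.
exact: (@le_bigmax _ _ _ 0 (fun ij : 'I_m * 'I_1 => `|x ij.1 ij.2|) (i, 0)).
Qed.

(** Change the coordinates one at a time.  The intermediate points stay in the
    closed ball of radius |x| because the norm is the maximum norm. *)
Lemma increment_partials f u x :
  (forall z, `|z - u| <= `|x| -> forall a, derivable f z 'u_a) ->
  exists2 z : 'I_m -> 'cV[R]_m, (forall a, `|z a - u| <= `|x|) &
    f (u + x) - f u = \sum_a x a 0 * 'D_('u_a) f (z a).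
Proof.
move=> df.
pose P (k : nat) : 'cV[R]_m := \col_a (if (a < k)%N then x a 0 else 0).
have PS (a : 'I_m) : P a.+1 = P a + x a 0 *: 'u_a.
  apply/colP => i; rewrite !mxE eqxx andbT.
  case: (eqVneq i a) => [->|ia]; first by rewrite ltnSn ltnn mulr1 add0r.
  by rewrite mulr0 addr0 ltnS leq_eqVlt val_eqE (negbTE ia).
have Pt (a : 'I_m) (t : R) : `|t| <= `|x a 0| -> `|u + P a + t *: 'u_a - u| <= `|x|.
  move=> ta; rewrite -(addrA u) addrAC subrr add0r.
  apply: norm_le_coord => i; rewrite !mxE eqxx andbT.
  case: (eqVneq i a) => [->|ia]; first by rewrite ltnn mulr1 add0r.
  by rewrite mulr0 addr0; case: ifP => // _; rewrite normr0.
have step (a : 'I_m) : exists z, `|z - u| <= `|x| /\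
    f (u + P a.+1) - f (u + P a) = x a 0 * 'D_('u_a) f z.
  have [t ta e] := @mvt_line R _ f (u + P a) ('u_a) (x a 0) (fun t ta => df _ (Pt a t ta) a).
  by exists (u + P a + t *: 'u_a); split; [exact: Pt | rewrite PS addrA].
have [z Hz] := choice step.
exists z => [a|]; first by case: (Hz a).
have -> : u + x = u + P m by congr (_ + _); apply/colP => i; rewrite mxE ltn_ord.
have -> : f u = f (u + P 0%N).
  by congr f; rewrite [P _](_ : _ = 0) ?addr0//; apply/colP => i; rewrite !mxE.
rewrite -(telescope_sumr (fun k => f (u + P k)) (leq0n m)) big_mkord.
by apply: eq_bigr => a _; case: (Hz a).
Qed.

Lemma ball_subnorm u (d : R) z x : ball u d (u + x) -> `|z - u| <= `|x| -> ball u d z.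
Proof.
rewrite -ball_normE /ball_/= opprD addrA subrr sub0r normrN => xd zx.
by rewrite distrC (le_lt_trans zx).
Qed.

Lemma locally_constant f u :
  (\forall z \near u, forall a, derivable f z 'u_a /\ 'D_('u_a) f z = 0) ->
  \forall z \near u, f z = f u.
Proof.
move=> H; have [d /= d0 Hd] := (nbhs_ballP u _).1 H.
apply/nbhs_ballP; exists d => //= y uy.
have [|z hz] := @increment_partials f u (y - u).
  by move=> z hz a; apply: (Hd z _ a).1; apply: ball_subnorm hz; rewrite addrC subrK.
rewrite [u + _]addrC subrK => /eqP; rewrite big1 ?subr_eq0; first by move/eqP.
move=> a _; rewrite (Hd (z a) _ a).2 ?mulr0//.
by apply: ball_subnorm (hz a); rewrite addrC subrK.
Qed.

Definition partials_differential f u x : R := \sum_a x a 0 * 'D_('u_a) f u.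

Lemma partials_differential_is_linear f u : linear (partials_differential f u).
Proof.
move=> k x y; rewrite /partials_differential scaler_sumr -big_split; apply: eq_bigr => a _ /=.
by rewrite !mxE mulrDl -mulrA.
Qed.

(** In [increment_partials] the partial derivatives are taken near u, where
    they differ little from their values at u. *)
Lemma C1_is_diff (f : 'cV[R]_m -> R^o) u : (\forall z \near u, forall a, derivable f z 'u_a) ->
  (forall a, {for u, continuous ('D_('u_a) f)}) ->
  is_diff u f (partials_differential f u).
Proof.
move=> df cf.
pose L : {linear 'cV[R]_m -> R^o} := HB.pack (partials_differential f u)
  (GRing.isLinear.Build _ _ _ _ _ (partials_differential_is_linear f u)).
have cL : continuous L.
  move=> y; apply/(@cvgrPdist_le _ _ _ (nbhs y) _ L (L y)) => e e0.
  pose C := 1 + \sum_a `|'D_('u_a) f u|.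
  have C0 : 0 < C by rewrite ltr_pwDl// sumr_ge0.
  near=> z; rewrite -linearB/= /partials_differential.
  have yz : `|y - z| <= e / C.
    by near: z; apply: cvgr_dist_le => //; rewrite divr_gt0.
  apply: (@le_trans _ _ (e / C * C)); last by rewrite divfK// gt_eqF.
  rewrite (le_trans (ler_norm_sum _ _ _))// /C mulrDr mulr1.
  rewrite ler_wpDl ?divr_ge0 ?(ltW e0) ?(ltW C0)// mulr_sumr.
  apply: ler_sum => a _; rewrite normrM; apply: ler_wpM2r => //.
  exact: le_trans (coord_le_norm _ _) yz.
have dL : f \o shift u = cst (f u) + L +o_ (0 : 'cV[R]_m) id.
  apply/(@eqaddoP R 'cV[R]_m R^o 'cV[R]_m (nbhs (0:'cV[R]_m))) => e e0 /=.
  have m1 : (0 : R) < m.+1%:R by rewrite ltr0n.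
  have e1 : 0 < e / m.+1%:R by rewrite divr_gt0.
  have cc : \forall z \near u, forall a, `|'D_('u_a) f u - 'D_('u_a) f z| <= e / m.+1%:R.
    apply: (@filter_forall _ _
      (fun a z => `|'D_('u_a) f u - 'D_('u_a) f z| <= e / m.+1%:R) (nbhs u)) => a.
    exact: ((@cvgrPdist_le R R^o _ (nbhs u) _ ('D_('u_a) f) ('D_('u_a) f u)).1 (cf a) _ e1).
  have [d /= d0 Hd] := (nbhs_ballP u _).1 (filterI df cc).
  apply/nbhs_ballP; exists d => //= x; rewrite -ball_normE /ball_/= sub0r normrN => xd.
  have ux : ball u d (u + x).
    by rewrite -ball_normE /ball_/= opprD addrA subrr sub0r normrN.
  have [|z hz E] := @increment_partials f u x.
    by move=> z hz a; apply: (Hd z (ball_subnorm ux hz)).1.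
  rewrite [X in `|X|](_ : _ = f (x + u) - (f u + partials_differential f u x))// [x + u]addrC.
  have -> : f (u + x) - (f u + partials_differential f u x) =
      \sum_a x a 0 * ('D_('u_a) f (z a) - 'D_('u_a) f u).
    rewrite opprD addrA E /partials_differential -sumrB; apply: eq_bigr => a _.
    by rewrite mulrBr.
  rewrite (le_trans (ler_norm_sum _ _ _))//.
  apply: (@le_trans _ _ (\sum_(a < m) `|x| * (e / m.+1%:R))).
    apply: ler_sum => a _; rewrite normrM; apply: ler_pM => //; first exact: coord_le_norm.
    by rewrite distrC; apply: (Hd _ (ball_subnorm ux (hz a))).2.
  rewrite sumr_const card_ord -mulrnAr [leRHS]mulrC ler_wpM2l//.
  rewrite -mulr_natr -mulrA ler_piMr ?(ltW e0)// mulrC ler_pdivrMr// mul1r.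
  by rewrite ler_nat.
have := diff_unique cL dL => E.
split; last exact: E.
by apply/diff_locallyP; rewrite E.
Unshelve. all: by end_near. Qed.

(** The direction v enters only through the curve T (u + h v), so f has to be
    differentiable but T needs derivatives along v only. *)
Lemma derive_chain n f (T : 'cV[R]_n -> 'cV[R]_m) (u v : 'cV[R]_n) :
  (\forall z \near (T u), forall a, derivable f z 'u_a) ->
  (forall a, {for T u, continuous ('D_('u_a) f)}) ->
  (forall a, derivable (fun w => T w a 0) u v) ->
  is_derive u v (f \o T) (\sum_a 'D_('u_a) f (T u) * 'D_v (fun w => T w a 0) u).
Proof.
move=> df cf dT.
have [Df df'] := C1_is_diff df cf.
have dTv : derivable T u v.
  by apply/derivable_mxP => i j; rewrite (ord1 j); exact: dT.
pose c := fun h : R => T (u + h *: v).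
have u0 : u = u + 0 *: v by rewrite scale0r addr0.
have dc : derivable c 0 1 by apply/derivable_line; rewrite -u0.
have dcE : 'D_1 c 0 = 'D_v T u by rewrite derive_line -u0.
have c0 : c 0 = T u by rewrite /c -u0.
have Dc : differentiable c 0 by apply/derivable1_diffP.
have Dfc : differentiable f (c 0) by rewrite c0.
have Dfcc : differentiable (f \o c) 0 by exact: differentiable_comp.
split.
  by rewrite u0; apply/derivable_line/derivable1_diffP.
have E1 : 'D_v (f \o T) u = 'D_1 (f \o c) 0.
  by rewrite (derive_line (f \o T)) -u0.
have E2 : 'D_1 (f \o c) 0 = 'd f (c 0) ('d c 0 1) by rewrite deriveE// diff_comp.
have E3 : 'd c 0 1 = 'D_v T u by rewrite -deriveE.
have E4 : 'd f (c 0) ('D_v T u) = partials_differential f (T u) ('D_v T u) by rewrite c0 df'.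
apply: etrans E1 (etrans E2 (etrans (congr1 _ E3) (etrans E4 _))).
rewrite /partials_differential; apply: eq_bigr => a _; rewrite mulrC; congr (_ * _).
by rewrite derive_mxE.
Qed.

End Coord.

Section Smooth.
Context {R : realType} {m : nat}.
Implicit Types (f : 'cV[R]_m -> R) (u : 'cV[R]_m) (U : set 'cV[R]_m).

Lemma smooth_continuous U f u : smooth_on U f -> U u -> {for u, continuous f}.
Proof. by move=> /(_ 0%N) [+ _] Uu; apply; rewrite inE. Qed.

Lemma smooth_derivable U f u a : smooth_on U f -> U u -> derivable f u 'u_a.
Proof. by move=> /(_ 1%N) [_ /(_ a)[+ _]] Uu; apply; rewrite inE. Qed.

Lemma smooth_derive U f a : smooth_on U f -> smooth_on U (fun u => 'D_('u_a) f u).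
Proof. by move=> sf k; have [_ /(_ a)[_]] := sf k.+1. Qed.

Lemma smooth_derivable_near U f u : open U -> smooth_on U f -> U u ->
  \forall z \near u, forall a, derivable f z 'u_a.
Proof.
move=> oU sf Uu; have : \forall z \near u, U z by exact: open_nbhs_nbhs.
by apply: filterS => z Uz a; exact: smooth_derivable Uz.
Qed.

Lemma smooth_schwarz U f u a b : open U -> smooth_on U f -> U u ->
  'D_('u_b) ('D_('u_a) f) u = 'D_('u_a) ('D_('u_b) f) u.
Proof.
move=> oU sf Uu.
have dd c : smooth_on U ('D_('u_c) f) by exact: smooth_derive.
have near_all g c : smooth_on U g -> \forall z \near u, derivable g z 'u_c.
  by move=> /(smooth_derivable_near oU)/(_ Uu); apply: filterS.
apply: mixed_derivatives; try exact: near_all.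
- exact: (smooth_continuous (smooth_derive b (dd a)) Uu).
- exact: (smooth_continuous (smooth_derive a (dd b)) Uu).
Qed.

Lemma smooth_chain n U f (T : 'cV[R]_n -> 'cV[R]_m) (u v : 'cV[R]_n) :
  open U -> smooth_on U f -> U (T u) ->
  (forall a, derivable (fun w => T w a 0) u v) ->
  is_derive u v (f \o T) (\sum_a 'D_('u_a) f (T u) * 'D_v (fun w => T w a 0) u).
Proof.
move=> oU sf Uu dT; apply: derive_chain dT => [|a].
  exact: smooth_derivable_near Uu.
exact: (smooth_continuous (smooth_derive a sf) Uu).
Qed.

Lemma smooth_cst U (c : R) : smooth_on U (fun=> c).
Proof.
move=> k; elim: k c => [|k IH] c /=; first by split=> // u _; exact: cst_continuous.
split=> [u _|a]; first exact: cst_continuous.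
split=> [u _|]; first exact: derivable_cst.
rewrite [X in Ck_on _ _ X](_ : _ = fun=> 0); first exact: IH.
by apply/funext => u; exact: derive_cst.
Qed.

Lemma Ck_on_sub k (U W : set 'cV[R]_m) f : W `<=` U -> Ck_on k U f -> Ck_on k W f.
Proof.
move=> WU; elim: k f => [|k IH] f /= [cf df].
  by split=> // u; rewrite inE => /WU Wu; apply: cf; rewrite inE.
split=> [u|a]; first by rewrite inE => /WU Wu; apply: cf; rewrite inE.
have [d c] := df a; split; last exact: IH.
by move=> u; rewrite inE => /WU Wu; apply: d; rewrite inE.
Qed.

Lemma smooth_on_sub (U W : set 'cV[R]_m) f : W `<=` U -> smooth_on U f -> smooth_on W f.
Proof. by move=> WU sf k; exact: Ck_on_sub (sf k). Qed.

End Smooth.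

Section SmoothMatrix.
Context {R : realType} {m : nat}.
Implicit Types (f : 'cV[R]_m -> R) (u x y : 'cV[R]_m) (U : set 'cV[R]_m).

Definition smooth_mx p q U (F : 'cV[R]_m -> 'M[R]_(p, q)) :=
  forall i j, smooth_on U (fun u => F u i j).

(** Partial derivatives determine the derivative in every direction. *)
Lemma smooth_is_derive U f u x : open U -> smooth_on U f -> U u ->
  is_derive u x f (\sum_a x a 0 * 'D_('u_a) f u).
Proof.
move=> oU sf Uu.
have [|a|df dE] := @C1_is_diff _ _ f u.
- exact: smooth_derivable_near Uu.
- exact: (smooth_continuous (smooth_derive a sf) Uu).
by split; [exact: diff_derivable | rewrite deriveE// dE].
Qed.

Lemma smooth_is_derive2 U f u x y : open U -> smooth_on U f -> U u ->
  is_derive u x ('D_y f) (\sum_b y b 0 * 'D_x ('D_('u_b) f) u).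
Proof.
move=> oU sf Uu.
apply: (@near_eq_is_derive _ _ _ (\sum_b (y b 0 \*: 'D_('u_b) f))).
  have : \forall z \near u, U z by exact: open_nbhs_nbhs.
  apply: filterS => z Uz; case: (smooth_is_derive y oU sf Uz) => _ ->.
  by rewrite fct_sumE.
apply: is_derive_sum => b; apply: is_deriveZ; apply: derivableP.
by case: (smooth_is_derive x oU (smooth_derive b sf) Uu).
Qed.

Lemma smooth_schwarz_dir U f u x y : open U -> smooth_on U f -> U u ->
  'D_x ('D_y f) u = 'D_y ('D_x f) u.
Proof.
move=> oU sf Uu.
case: (smooth_is_derive2 x y oU sf Uu) => _ ->.
case: (smooth_is_derive2 y x oU sf Uu) => _ ->.
have E z b : 'D_z ('D_('u_b) f) u = \sum_a z a 0 * 'D_('u_a) ('D_('u_b) f) u.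
  by case: (smooth_is_derive z oU (smooth_derive b sf) Uu).
have EE y' x' : \sum_b y' b 0 * 'D_x' ('D_('u_b) f) u =
    \sum_b \sum_a y' b 0 * (x' a 0 * 'D_('u_a) ('D_('u_b) f) u).
  by apply: eq_bigr => b _; rewrite E mulr_sumr.
apply: etrans (EE y x) _; apply: etrans _ (esym (EE x y)).
rewrite exchange_big/=; apply: eq_bigr => a _; apply: eq_bigr => b _.
by rewrite mulrCA (smooth_schwarz _ _ oU sf Uu).
Qed.

Lemma smooth_mx_derivable p q U (F : 'cV[R]_m -> 'M[R]_(p, q)) u x :
  open U -> smooth_mx U F -> U u -> derivable F u x.
Proof.
move=> oU sF Uu; apply/derivable_mxP => i j.
by case: (smooth_is_derive x oU (sF i j) Uu).
Qed.

Lemma smooth_mx_deriveE p q U (F : 'cV[R]_m -> 'M[R]_(p, q)) u x :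
  open U -> smooth_mx U F -> U u -> 'D_x F u = \sum_a x a 0 *: 'D_('u_a) F u.
Proof.
move=> oU sF Uu; have dF y : derivable F u y by exact: smooth_mx_derivable Uu.
apply/matrixP => i j; rewrite derive_mxE// summxE.
case: (smooth_is_derive x oU (sF i j) Uu) => _ ->.
by apply: eq_bigr => a _; rewrite mxE derive_mxE.
Qed.

Lemma smooth_mx_derivable2 p q U (F : 'cV[R]_m -> 'M[R]_(p, q)) u x y :
  open U -> smooth_mx U F -> U u -> derivable ('D_y F) u x.
Proof.
move=> oU sF Uu; apply/derivable_mxP => i j.
have [dy _] := smooth_is_derive2 x y oU (sF i j) Uu.
apply: near_eq_derivable dy.
have : \forall z \near u, U z by exact: open_nbhs_nbhs.
apply: filterS => z Uz; rewrite derive_mxE//.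
exact: smooth_mx_derivable Uz.
Qed.

Lemma smooth_mx_schwarz p q U (F : 'cV[R]_m -> 'M[R]_(p, q)) u x y :
  open U -> smooth_mx U F -> U u -> 'D_x ('D_y F) u = 'D_y ('D_x F) u.
Proof.
move=> oU sF Uu; apply/matrixP => i j.
have E z w : ('D_z ('D_w F) u) i j = 'D_z ('D_w (fun v => F v i j)) u.
  rewrite derive_mxE; last exact: smooth_mx_derivable2 Uu.
  apply: near_eq_derive.
  have : \forall z \near u, U z by exact: open_nbhs_nbhs.
  apply: filterS => v Uv; rewrite derive_mxE//.
  exact: smooth_mx_derivable Uv.
apply: etrans (E x y) _; apply: etrans _ (esym (E y x)).
exact: smooth_schwarz_dir Uu.
Qed.

End SmoothMatrix.

(** * Exterior derivative *)

Section ExteriorDerivative.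
Context {R : realType} {m : nat}.
Implicit Types (u x y z : 'cV[R]_m) (U : set 'cV[R]_m) (om : 'cV[R]_m -> 'rV[R]_m).

(** The exterior derivative of a 1-form. *)
Definition dform om u : 'M[R]_m :=
  \matrix_(a, b) (('D_('u_a) om u) 0 b - ('D_('u_b) om u) 0 a).

Lemma bilE (B : 'M[R]_m) x y : bil B x y = \sum_a \sum_b x a 0 * y b 0 * B a b.
Proof.
rewrite /bil mxE exchange_big/=; apply: eq_bigr => b _.
rewrite mxE mulr_suml; apply: eq_bigr => a _; rewrite mxE; ring.
Qed.

Lemma bil_dform U om u y z : open U -> smooth_mx U om -> U u ->
  bil (dform om u) y z = ev ('D_y om u) z - ev ('D_z om u) y.
Proof.
move=> oU som Uu; rewrite bilE /ev.
have E s t : ('D_s om u *m t) 0 0 = \sum_a \sum_b s a 0 * t b 0 * ('D_('u_a) om u) 0 b.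
  rewrite (smooth_mx_deriveE s oU som Uu) mulmx_suml summxE; apply: eq_bigr => a _.
  rewrite -scalemxAl !mxE mulr_sumr; apply: eq_bigr => b _; ring.
rewrite !E [X in _ = _ - X]exchange_big/= -sumrB; apply: eq_bigr => a _.
rewrite -sumrB; apply: eq_bigr => b _; rewrite mxE; ring.
Qed.

Lemma is_derive_ev om u x y dom : is_derive u x om dom ->
  is_derive u x (fun v => ev (om v) y) (ev dom y).
Proof.
move=> dom'; have := is_derive_mulmx dom' (is_derive_cst y u x).
rewrite mulmx0 addr0 => -[d e]; split; first exact: ((derivable_mxP _ _ _).1 d 0 0).
by rewrite /ev -e derive_mxE//.
Qed.

(** d d = 0; x, y and z are constant, so there are no bracket terms. *)
Lemma dform_closed U om u x y z : open U -> smooth_mx U om -> U u ->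
  'D_x (fun v => bil (dform om v) y z) u + 'D_y (fun v => bil (dform om v) z x) u +
  'D_z (fun v => bil (dform om v) x y) u = 0.
Proof.
move=> oU som Uu.
have [S SE] : exists S, forall s t r, ev ('D_s ('D_t om) u) r = S s t r by eexists.
have SC s t r : S s t r = S t s r.
  apply: etrans (esym (SE s t r)) (etrans _ (SE t s r)).
  exact: (congr1 (fun B => ev B r) (smooth_mx_schwarz s t oU som Uu)).
have D s t r : 'D_s (fun v => bil (dform om v) t r) u = S s t r - S s r t.
  have d k : is_derive u s ('D_k om) ('D_s ('D_k om) u).
    by apply: derivableP; exact: smooth_mx_derivable2 Uu.
  have [_ e] := is_deriveB (is_derive_ev r (d t)) (is_derive_ev t (d r)).
  apply: etrans (congr2 (fun a b => a - b) (SE s t r) (SE s r t)).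
  apply: etrans e; apply: near_eq_derive.
  have : \forall z \near u, U z by exact: open_nbhs_nbhs.
  by apply: filterS => v Uv; exact: bil_dform Uv.
apply: etrans (congr2 +%R (congr2 +%R (D x y z) (D y z x)) (D z x y)) _.
rewrite (SC y x) (SC z x) (SC z y); ring.
Qed.

Lemma dform_derivable U om u x y z : open U -> smooth_mx U om -> U u ->
  derivable (fun v => bil (dform om v) y z) u x.
Proof.
move=> oU som Uu.
have d k : is_derive u x ('D_k om) ('D_x ('D_k om) u).
  by apply: derivableP; exact: smooth_mx_derivable2 Uu.
have [H _] := is_deriveB (is_derive_ev z (d y)) (is_derive_ev y (d z)).
apply: near_eq_derivable H.
have : \forall z \near u, U z by exact: open_nbhs_nbhs.
by apply: filterS => v Uv; apply/esym; exact: bil_dform Uv.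
Qed.

(** The hypothesis is eta /\ Om = 0.  Contracting it with the inverse of Om
    gives (m - 2) eta = 0. *)
Lemma wedge_nondegenerate (Om : 'M[R]_m) (eta : 'rV[R]_m) :
  m <> 2%N -> Om \in unitmx -> Om^T = - Om ->
  (forall a b c, eta 0 a * Om b c + eta 0 b * Om c a + eta 0 c * Om a b = 0) ->
  eta = 0.
Proof.
move=> m2 Omu OmT H; apply/rowP => a; rewrite [RHS]mxE.
have E : eta 0 a *: Om + eta^T *m (col a Om)^T + (row a Om)^T *m eta = 0.
  apply/matrixP => b c; rewrite !mxE !big_ord1 !mxE -[RHS](H a b c).
  by rewrite [Om a b * _]mulrC.
have E1 : (col a Om)^T *m invmx Om = - ('u_a : 'cV[R]_m)^T.
  by rewrite tr_col OmT -row_mul mulNmx mulmxV// raddfN/= row1 trmx_delta.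
have E2 : (row a Om)^T = - (Om *m 'u_a) by rewrite tr_row OmT raddfN/= colE.
have := congr1 (fun B => \tr (B *m invmx Om)) E.
rewrite mul0mx mxtrace0 !mulmxDl !raddfD/= -scalemxAl mulmxV// mxtraceZ mxtrace1.
rewrite -(mulmxA eta^T) E1 E2 mulmxN raddfN/= mxtrace_mulC [\tr (_ *m eta *m _)]mxtrace_mulC.
rewrite !mulNmx mulmxN mulmxA mulmxA mulVmx// mul1mx raddfN/= [\tr ('u_a *m eta)]mxtrace_mulC.
have -> : \tr (eta *m 'u_a) = eta 0 a by rewrite -colE /mxtrace big_ord1 mxE.
have -> : \tr (('u_a : 'cV[R]_m)^T *m eta^T) = eta 0 a.
  by rewrite -trmx_mul mxtrace_tr -colE /mxtrace big_ord1 mxE.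
move=> h; have : (m%:R - 2) * eta 0 a = 0 by rewrite -h; ring.
move/eqP; rewrite mulf_eq0 subr_eq0 (eqr_nat R m 2) => /orP[/eqP//|/eqP//].
Qed.

End ExteriorDerivative.

Section Pullback.
Context {R : realType} {m : nat}.
Variables (U O : set 'cV[R]_m) (om om' : 'cV[R]_m -> 'rV[R]_m) (T : 'cV[R]_m -> 'cV[R]_m).
Hypotheses (oU : open U) (oO : open O) (som : smooth_mx U om) (sT : smooth_mx O T).

Definition jacobian_mx (v : 'cV[R]_m) : 'M[R]_m :=
  \matrix_(a, b) 'D_('u_b) (fun w => T w a 0) v.

(** Naturality of d: the second derivatives of T cancel by symmetry. *)
Lemma dform_pullback u : O u -> U (T u) ->
  (\forall v \near u, om' v = om (T v) *m jacobian_mx v) ->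
  dform om' u = (jacobian_mx u)^T *m dform om (T u) *m jacobian_mx u.
Proof.
move=> Ou UTu near_om.
have sTa a : smooth_on O (fun w => T w a 0) by exact: sT.
have dT a b : derivable (fun w => T w a 0) u 'u_b.
  exact: smooth_derivable (sTa a) Ou.
have [H HE] : exists H, forall c a b,
    'D_('u_c) ('D_('u_b) (fun w => T w a 0)) u = H c a b by eexists.
have HC c a b : H c a b = H b a c.
  apply: etrans (esym (HE c a b)) (etrans _ (HE b a c)).
  exact: (smooth_schwarz _ _ oO (sTa a) Ou).
have dJ c : is_derive u 'u_c jacobian_mx (\matrix_(a, b) H c a b).
  have D : derivable jacobian_mx u 'u_c.
    apply/derivable_mxP => a b.
    rewrite (_ : (fun v => _) = 'D_('u_b) (fun w => T w a 0)).
      exact: smooth_derivable (smooth_derive b (sTa a)) Ou.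
    by apply/funext => v; rewrite mxE.
  split=> //; apply/matrixP => a b; rewrite derive_mxE// mxE -HE.
  apply: (congr1 (fun f => 'D_('u_c) f u)); apply/funext => v; by rewrite mxE.
have dom c : is_derive u 'u_c (om \o T)
    (\sum_d jacobian_mx u d c *: 'D_('u_d) om (T u)).
  have chain b := smooth_chain oU (som 0 b) UTu (dT^~ c).
  have d : derivable (om \o T) u 'u_c.
    by apply/derivable_mxP => i b; rewrite (ord1 i); case: (chain b).
  split=> //; apply/matrixP => i b; rewrite (ord1 i) derive_mxE// summxE.
  have [_ e] := chain b; apply: etrans e _; apply: eq_bigr => d' _.
  rewrite [RHS]mxE [jacobian_mx u d' c]mxE mulrC; congr (_ * _); apply/esym.
  by apply: derive_mxE; exact: smooth_mx_derivable UTu.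
have D c : 'D_('u_c) om' u = (\sum_d jacobian_mx u d c *: 'D_('u_d) om (T u)) *m jacobian_mx u
     + om (T u) *m \matrix_(a, b) H c a b.
  have [_ e] := is_derive_mulmx (dom c) (dJ c); apply: etrans e.
  exact: near_eq_derive.
have [Dm DmE] : exists Dm : 'I_m -> 'I_m -> R, forall d a, ('D_('u_d) om (T u)) 0 a = Dm d a.
  by eexists.
have Jm d c : jacobian_mx u d c = 'D_('u_c) (fun w => T w d 0) u by rewrite mxE.
have {}D c b : ('D_('u_c) om' u) 0 b = \sum_a \sum_d
   jacobian_mx u d c * Dm d a * jacobian_mx u a b + \sum_a om (T u) 0 a * H c a b.
  rewrite D mxE; congr (_ + _); rewrite mxE; apply: eq_bigr => a _; last by rewrite mxE.
  rewrite summxE mulr_suml; apply: eq_bigr => d _; by rewrite mxE DmE.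
apply/matrixP => c b.
have -> : dform om' u c b = ('D_('u_c) om' u) 0 b - ('D_('u_b) om' u) 0 c by rewrite mxE.
rewrite (D c b) (D b c) opprD addrACA.
have -> : \sum_a om (T u) 0 a * H c a b = \sum_a om (T u) 0 a * H b a c.
  by apply: eq_bigr => a _; rewrite HC.
rewrite subrr addr0 [X in _ - X]exchange_big/= -sumrB mxE; apply: eq_bigr => a _.
rewrite -sumrB [(_ *m _) _ _]mxE mulr_suml; apply: eq_bigr => d _.
rewrite [dform _ _ _ _]mxE !DmE [_^T _ _]mxE; ring.
Qed.

End Pullback.

(** * Connections and curvature *)

Section CurvatureIdentity.
Context {R : realType} {m : nat}.
Implicit Types (u x y : 'cV[R]_m) (U : set 'cV[R]_m).

(** Symmetry of the second derivatives of F, when F obeys a linear first order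
    equation D F = P F + F Q + w E coupled to D E = P E + E Q - w F.  With
    P = - Gamma, Q = Gamma this is an endomorphism and the identity computes
    its commutator with the curvature; with P = Gamma^T, Q = Gamma and w = 0 it
    is a bilinear form and the identity says that the curvature is skew. *)
Lemma curvature_identity U (P Q : 'cV[R]_m -> 'cV[R]_m -> 'M[R]_m)
    (F E : 'cV[R]_m -> 'M[R]_m) (w : 'cV[R]_m -> 'cV[R]_m -> R)
    (dP dQ : 'cV[R]_m -> 'cV[R]_m -> 'M[R]_m) (dw : 'cV[R]_m -> 'cV[R]_m -> R) u :
  open U -> U u -> smooth_mx U F ->
  (forall z t, is_derive u z (P t) (dP z t)) ->
  (forall z t, is_derive u z (Q t) (dQ z t)) ->
  (forall z t, is_derive u z (w t) (dw z t)) ->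
  (forall z v, U v -> 'D_z F v = P z v *m F v + F v *m Q z v + w z v *: E v) ->
  (forall z, is_derive u z E (P z u *m E u + E u *m Q z u - w z u *: F u)) ->
  forall x y,
  (dP x y - dP y x + P y u *m P x u - P x u *m P y u) *m F u +
  F u *m (dQ x y - dQ y x + Q x u *m Q y u - Q y u *m Q x u) +
  (dw x y - dw y x) *: E u = 0.
Proof.
move=> oU Uu sF DP DQ Dw DF DE x y.
have Unear : \forall z \near u, U z by exact: open_nbhs_nbhs.
have dF t : is_derive u t F (P t u *m F u + F u *m Q t u + w t u *: E u).
  rewrite -DF//; apply: derivableP; exact: smooth_mx_derivable Uu.
have D2 z t : 'D_t ('D_z F) u =
    dP t z *m F u + P z u *m (P t u *m F u + F u *m Q t u + w t u *: E u) +
    ((P t u *m F u + F u *m Q t u + w t u *: E u) *m Q z u + F u *m dQ t z) +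
    (dw t z *: E u + w z u *: (P t u *m E u + E u *m Q t u - w t u *: F u)).
  have [_ e] := is_deriveD (is_deriveD (is_derive_mulmx (DP t z) (dF t))
    (is_derive_mulmx (dF t) (DQ t z))) (is_derive_scalemx (Dw t z) (DE t)).
  apply: etrans e; apply: near_eq_derive.
  by apply: filterS Unear => v Uv; exact: DF.
have := etrans (esym (D2 y x)) (etrans (smooth_mx_schwarz x y oU sF Uu) (D2 x y)).
move=> {D2 dF DP DQ Dw DF DE}.
move: (dP x y) (dP y x) (dQ x y) (dQ y x) (dw x y) (dw y x)
  (P x u) (P y u) (Q x u) (Q y u) (w x u) (w y u) (F u) (E u).
move=> dPy' dPx' dQy' dQx' a b p p' q q' c c' f e.
rewrite !mulmxDr !mulmxDl ?mulNmx ?mulmxN -?scalemxAl -?scalemxAr ?mulmxA.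
rewrite !scalerDr ?scalerN ?scalerA (mulrC c' c) !scalerBl.
move: (p *m p' *m f) (p' *m p *m f) => x1 x2.
move: (p *m f *m q') (p' *m f *m q) (f *m q *m q') (f *m q' *m q) => x3 x4 x5 x6.
move: (p *m e) (p' *m e) (e *m q) (e *m q') => x7 x8 x9 x10.
move: (dPy' *m f) (dPx' *m f) (f *m dQy') (f *m dQx') => x11 x12 x13 x14.
move=> H; apply/matrixP => i j; have /matrixP/(_ i j) := H.
rewrite !mxE; move=> h; lra.
Qed.

End CurvatureIdentity.

(** [C a] is the matrix of the Christoffel symbols in the direction of the
    a-th coordinate; [conn x] is the connection matrix in the direction x. *)
Section ConnectionMatrices.
Context {R : realType} {m : nat}.
Variables (U : set 'cV[R]_m) (C : 'I_m -> 'cV[R]_m -> 'M[R]_m).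
Implicit Types (u v x y z : 'cV[R]_m).
Hypotheses (oU : open U) (sC : forall a, smooth_mx U (C a)).

Definition conn x u : 'M[R]_m := \sum_a x a 0 *: C a u.

Definition curv x y u : 'M[R]_m :=
  'D_x (conn y) u - 'D_y (conn x) u + conn x u *m conn y u - conn y u *m conn x u.

(** The matrix of the map x |-> R(x, y) z; its trace is the Ricci tensor. *)
Definition curv_trace_mx y z u : 'M[R]_m :=
  \matrix_(c, a) (curv 'u_a y u *m z) c 0.

Lemma is_derive_conn x y u : U u ->
  is_derive u x (conn y) (\sum_b y b 0 *: 'D_x (C b) u).
Proof.
move=> Uu; have -> : conn y = \sum_b (y b 0 \*: C b).
  by apply/funext => v; rewrite fct_sumE.
apply: is_derive_sum => b; apply: is_deriveZ; apply: derivableP.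
exact: smooth_mx_derivable Uu.
Qed.

Lemma conn_derivable x y u : U u -> derivable (conn y) u x.
Proof. by move=> /(is_derive_conn x y)[]. Qed.

Lemma conn_deriveE x y u : U u ->
  'D_x (conn y) u = \sum_a x a 0 *: 'D_('u_a) (conn y) u.
Proof.
move=> Uu; case: (is_derive_conn x y Uu) => _ ->.
rewrite [RHS](eq_bigr (fun a => \sum_b x a 0 *: (y b 0 *: 'D_('u_a) (C b) u))).
  rewrite exchange_big/=; apply: eq_bigr => b _.
  rewrite (smooth_mx_deriveE x oU (sC b) Uu) scaler_sumr; apply: eq_bigr => a _.
  by rewrite !scalerA mulrC.
by move=> a _; case: (is_derive_conn 'u_a y Uu) => _ ->; rewrite scaler_sumr.
Qed.

Lemma curvE x y u : U u -> curv x y u = \sum_a x a 0 *: curv 'u_a y u.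
Proof.
move=> Uu; rewrite /curv (conn_deriveE x y Uu).
have conn1 a v : conn 'u_a v = C a v.
  rewrite /conn (bigD1 a)//= big1 ?addr0 => [|b ba]; rewrite mxE ?eqxx ?scale1r//.
  by rewrite (negbTE ba) scale0r.
have -> : 'D_y (conn x) u = \sum_a x a 0 *: 'D_y (conn 'u_a) u.
  case: (is_derive_conn y x Uu) => _ ->; apply: eq_bigr => a _.
  by congr (_ *: 'D_y _ u); apply/funext => v; rewrite conn1.
rewrite [conn x u]/conn mulmx_suml mulmx_sumr -!sumrB -big_split/= -sumrB.
apply: eq_bigr => a _; rewrite scalerBr scalerDr scalerBr conn1.
by rewrite -scalemxAl -scalemxAr.
Qed.

Lemma curv_trace_mxP x y z u : U u -> curv x y u *m z = curv_trace_mx y z u *m x.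
Proof.
move=> Uu; rewrite (curvE _ _ Uu) mulmx_suml; apply/colP => c.
rewrite summxE !mxE; apply: eq_bigr => a _.
by rewrite -scalemxAl !mxE mulrC.
Qed.

Lemma curvC x y u : curv x y u = - curv y x u.
Proof. by rewrite /curv !opprD !opprK (addrC (- _)) addrAC -!addrA. Qed.

(** Torsion freeness is symmetry of [conn s v *m t] in s and t; it passes to
    the derivatives, and then all terms cancel in pairs. *)
Lemma curv_bianchi x y z u : U u -> (forall v s t, U v -> conn s v *m t = conn t v *m s) ->
  curv x y u *m z + curv y z u *m x + curv z x u *m y = 0.
Proof.
move=> Uu sym.
have [T TE] : exists T, forall s t r : 'cV[R]_m, 'D_s (conn t) u *m r = T s t r by eexists.
have [Q QE] : exists Q, forall s t r : 'cV[R]_m, conn s u *m conn t u *m r = Q s t r by eexists.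
have Tsym s t r : T s t r = T s r t.
  have d k (l : 'cV[R]_m) : is_derive u s (fun v => conn k v *m l) (T s k l).
    have dk : derivable (conn k) u s by exact: conn_derivable.
    by have := is_derive_mulmx (derivableP dk) (is_derive_cst l u s); rewrite mulmx0 addr0 TE.
  case: (d t r) => _ <-; case: (d r t) => _ <-.
  apply: near_eq_derive.
  have : \forall z \near u, U z by exact: open_nbhs_nbhs.
  by apply: filterS => v Uv; exact: sym.
have Qsym s t r : Q s t r = Q s r t by rewrite -!QE -!mulmxA (sym u t r).

have E s t r : curv s t u *m r = T s t r - T t s r + Q s t r - Q t s r.
  by rewrite -!TE -!QE /curv !mulmxDl !mulNmx.
rewrite !E (Tsym y z) (Tsym z x) (Tsym x y) (Qsym y z) (Qsym z x) (Qsym x y).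
move: (T x z y) (T y x z) (T z y x) (Q x z y) (Q y x z) (Q z y x) => a b c d e f.
by apply/matrixP => i j; rewrite !mxE; ring.
Qed.

End ConnectionMatrices.

(** * The structure in one chart *)

Section NHChart.
Context {R : realType} {m : nat}.
Variables (U : set 'cV[R]_m) (C : 'I_m -> 'cV[R]_m -> 'M[R]_m)
  (G J1 J2 J3 : 'cV[R]_m -> 'M[R]_m) (om : 'cV[R]_m -> 'rV[R]_m).
Implicit Types (u v x y z : 'cV[R]_m).
Local Notation conn := (conn C).
Local Notation curv := (curv C).

(** The local form of the structure once omega_2 = omega_3 = 0: J_1 is
    parallel and [om], which is omega_1, rotates J_2 and J_3. *)
Record NH_chart : Prop := NHChart {
  NH_open : open U ;
  NH_smooth_conn : forall a, smooth_mx U (C a) ;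
  NH_smooth_metric : smooth_mx U G ;
  NH_smooth1 : smooth_mx U J1 ;
  NH_smooth2 : smooth_mx U J2 ;
  NH_smooth3 : smooth_mx U J3 ;
  NH_smooth_form : smooth_mx U om ;
  NH_chart_algebra : forall u, U u -> NH_algebra (G u) (J1 u) (J2 u) (J3 u) ;
  NH_torsion_free : forall u x y, U u -> conn x u *m y = conn y u *m x ;
  NH_metric_parallel : forall x u, U u ->
    'D_x G u = (conn x u)^T *m G u + G u *m conn x u ;
  NH_D1 : forall x u, U u -> 'D_x J1 u = J1 u *m conn x u - conn x u *m J1 u ;
  NH_D2 : forall x u, U u -> 'D_x J2 u =
    J2 u *m conn x u - conn x u *m J2 u + ev (om u) x *: J3 u ;
  NH_D3 : forall x u, U u -> 'D_x J3 u =
    J3 u *m conn x u - conn x u *m J3 u - ev (om u) x *: J2 u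
}.

Hypothesis NH : NH_chart.
Let oU := NH_open NH.
Let sC := NH_smooth_conn NH.
Let sG := NH_smooth_metric NH.
Let som := NH_smooth_form NH.

Let derive_conn x z u : U u -> is_derive u z (conn x) ('D_z (conn x) u).
Proof. by move=> Uu; apply: derivableP; exact: (conn_derivable oU sC). Qed.

Let derive_oppconn x z u : U u -> is_derive u z (fun v => - conn x v) (- 'D_z (conn x) u).
Proof. by move=> Uu; apply: is_deriveN; exact: derive_conn. Qed.

Let derive_form x z u : U u -> is_derive u z (fun v => ev (om v) x) (ev ('D_z om u) x).
Proof.
by move=> Uu; apply: is_derive_ev; apply: derivableP; exact: smooth_mx_derivable Uu.
Qed.

Let curvNE x y u : - 'D_x (conn y) u - - 'D_y (conn x) u + - conn y u *m - conn x u -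
   - conn x u *m - conn y u = - curv x y u.
Proof.
rewrite /curv !mulNmx !mulmxN !opprK.
move: ('D_x _ u) ('D_y _ u) (conn x u *m _) (conn y u *m _) => a b c d.
by apply/matrixP => i j; rewrite !mxE; ring.
Qed.

Lemma curv_comm_J1 u x y : U u -> curv x y u *m J1 u = J1 u *m curv x y u.
Proof.
move=> Uu.
have D z v : U v -> 'D_z J1 v = - conn z v *m J1 v + J1 v *m conn z v + 0 *: 0.
  by move=> Uv; rewrite NH_D1// scale0r addr0 mulNmx addrC.
have D0 z : is_derive u z (fun=> 0 : 'M[R]_m)
    (- conn z u *m 0 + 0 *m conn z u - 0 *: J1 u).
  by rewrite mulmx0 mul0mx scale0r subr0 addr0; exact: is_derive_cst.
have := curvature_identity oU Uu (NH_smooth1 NH) (fun z t => derive_oppconn t z Uu)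
  (fun z t => derive_conn t z Uu) (fun z t => is_derive_cst (0 : R) u z) D D0 x y.
rewrite (curvNE x y u) scaler0 addr0 mulNmx => H.
by apply/esym/eqP; rewrite -subr_eq0 addrC; apply/eqP.
Qed.

Lemma curv_comm_J2 u x y : U u ->
  curv x y u *m J2 u = J2 u *m curv x y u + bil (dform om u) x y *: J3 u.
Proof.
move=> Uu.
have D z v : U v -> 'D_z J2 v =
    - conn z v *m J2 v + J2 v *m conn z v + ev (om v) z *: J3 v.
  by move=> Uv; rewrite NH_D2// mulNmx [- _ + _]addrC.
have D' z : is_derive u z J3
    (- conn z u *m J3 u + J3 u *m conn z u - ev (om u) z *: J2 u).
  rewrite mulNmx [- _ + _]addrC -NH_D3//; apply: derivableP.
  exact: (smooth_mx_derivable oU (NH_smooth3 NH) Uu).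
have := curvature_identity oU Uu (NH_smooth2 NH) (fun z t => derive_oppconn t z Uu)
  (fun z t => derive_conn t z Uu) (fun z t => derive_form t z Uu) D D' x y.
rewrite (curvNE x y u) mulNmx (bil_dform _ _ oU som Uu) => H.
by apply/esym/eqP; rewrite -subr_eq0 addrC addrA; apply/eqP.
Qed.

Lemma curv_skew u x y : U u -> (curv x y u)^T *m G u = - (G u *m curv x y u).
Proof.
move=> Uu.
have D z v : U v -> 'D_z G v = (conn z v)^T *m G v + G v *m conn z v + 0 *: 0.
  by move=> Uv; rewrite NH_metric_parallel// scale0r addr0.
have D0 z : is_derive u z (fun=> 0 : 'M[R]_m)
    ((conn z u)^T *m 0 + 0 *m conn z u - 0 *: G u).
  by rewrite mulmx0 mul0mx scale0r subr0 addr0; exact: is_derive_cst.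
have := curvature_identity oU Uu sG (fun z t => is_derive_trmx (derive_conn t z Uu))
  (fun z t => derive_conn t z Uu) (fun z t => is_derive_cst (0 : R) u z) D D0 x y.
rewrite scaler0 addr0 => H; apply/eqP; rewrite -addr_eq0; apply/eqP.
apply: etrans H; congr (_ *m _ + _).
by rewrite /curv raddfB/= raddfD/= raddfB/= !trmx_mul.
Qed.

Hypotheses (m0 : (0 < m)%N) (m4 : m <> 4%N) (m2 : m <> 2%N).

Lemma chart_einstein u : U u -> exists lambda : R,
  (forall y z, \tr (curv_trace_mx C y z u) = lambda * bil (G u) y z) /\
  (forall x y, m%:R * bil (dform om u) x y = 4 * lambda * bil (G u) x (J1 u *m y)).
Proof.
move=> Uu.
apply: (@pointwise_einstein _ _ (G u) (J1 u) (J2 u) (J3 u) (dform om u) (fun x y => curv x y u)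
  (fun y z => curv_trace_mx C y z u) m0 m4 (NH_chart_algebra NH Uu)).
- by move=> x y; exact: curvC.
- by move=> x y z; exact: (curv_trace_mxP oU sC).
- by move=> x y z; apply: (curv_bianchi oU sC) => // v s t Uv; exact: NH_torsion_free.
- by move=> x y; exact: curv_skew.
- by move=> x y; exact: curv_comm_J1.
- by move=> x y; exact: curv_comm_J2.
Qed.

End NHChart.

Section ClosedMultiple.
Context {R : realType}.

Lemma closed_multiple (k h b1 b2 b3 p1 p2 p3 q1 q2 q3 w1 w2 w3 : R) :
  k * b1 = 4 * (p1 * q1 + h * w1) -> k * b2 = 4 * (p2 * q2 + h * w2) ->
  k * b3 = 4 * (p3 * q3 + h * w3) ->
  b1 + b2 + b3 = 0 -> w1 + w2 + w3 = 0 -> p1 * q1 + p2 * q2 + p3 * q3 = 0.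
Proof.
move=> D1 D2 D3 Hb Hw.
have Eb : k * b1 + k * b2 + k * b3 = 0 by rewrite -!mulrDr Hb mulr0.
have Ew : h * w1 + h * w2 + h * w3 = 0 by rewrite -!mulrDr Hw mulr0.
lra.
Qed.

End ClosedMultiple.

Section KahlerForm.
Context {R : realType} {m : nat}.
Variables (U : set 'cV[R]_m) (C : 'I_m -> 'cV[R]_m -> 'M[R]_m)
  (G J1 J2 J3 : 'cV[R]_m -> 'M[R]_m) (om : 'cV[R]_m -> 'rV[R]_m).
Implicit Types (u v x y z : 'cV[R]_m).
Local Notation conn := (conn C).
Hypothesis NH : NH_chart U C G J1 J2 J3 om.
Let oU := NH_open NH.
Let sG := NH_smooth_metric NH.
Let sJ := NH_smooth1 NH.
Let som := NH_smooth_form NH.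

(** The Kaehler form g(x, J_1 y). *)
Let Om v := G v *m J1 v.

Lemma Kahler_unit v : U v -> Om v \in unitmx.
Proof.
move=> Uv; have A := NH_chart_algebra NH Uv.
rewrite unitmx_mul (NH_unit A)/=.
suff /mulmx1_unit[] : J1 v *m - J1 v = 1%:M by [].
by rewrite mulmxN (NH_J11 A) opprK.
Qed.

Lemma Kahler_skew v : U v -> (Om v)^T = - Om v.
Proof.
move=> Uv; have A := NH_chart_algebra NH Uv.
by rewrite trmx_mul (NH_sym A) (NH_adj1 A).
Qed.

Lemma Kahler_parallel x u : U u ->
  is_derive u x Om ((conn x u)^T *m Om u + Om u *m conn x u).
Proof.
move=> Uu.
have dG : derivable G u x by exact: (smooth_mx_derivable oU sG Uu).
have dJ : derivable J1 u x by exact: (smooth_mx_derivable oU sJ Uu).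
apply: is_derive_eq (is_derive_mulmx (derivableP dG) (derivableP dJ)) _.
rewrite (NH_metric_parallel NH x Uu) (NH_D1 NH x Uu) /Om.
rewrite mulmxBr mulmxDl !mulmxA.
move: (_ *m G u *m J1 u) (G u *m J1 u *m _) (G u *m _ *m J1 u) => a b c.
by apply/matrixP => i j; rewrite !mxE; ring.
Qed.

Lemma is_derive_bil (F : 'cV[R]_m -> 'M[R]_m) u x dF y z : is_derive u x F dF ->
  is_derive u x (fun v => bil (F v) y z) (bil dF y z).
Proof.
move=> dF'.
have d1 := is_derive_mulmx (is_derive_cst y^T u x) dF'.
have [d e] := is_derive_mulmx d1 (is_derive_cst z u x).
split; first exact: ((derivable_mxP _ _ _).1 d 0 0).
have E := derive_mxE 0 0 d; apply: etrans (esym E) _.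
by rewrite e mul0mx add0r mulmx0 addr0.
Qed.

(** A parallel form is closed when the connection has no torsion. *)
Lemma Kahler_closed u x y z : U u ->
  'D_x (fun v => bil (Om v) y z) u + 'D_y (fun v => bil (Om v) z x) u +
  'D_z (fun v => bil (Om v) x y) u = 0.
Proof.
move=> Uu.
have D s t r : 'D_s (fun v => bil (Om v) t r) u =
    bil (Om u) (conn s u *m t) r + bil (Om u) t (conn s u *m r).
  have [_ e] := is_derive_bil t r (Kahler_parallel s Uu); apply: etrans e _.
  by rewrite bil_mull bil_mulr /bil mulmxDr mulmxDl mxE.
apply: etrans (congr2 +%R (congr2 +%R (D x y z) (D y z x)) (D z x y)) _ => {D}.
have skew s t : bil (Om u) s t = - bil (Om u) t s.
  by rewrite bilC (Kahler_skew Uu) /bil mulmxN mulNmx mxE.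
rewrite (NH_torsion_free NH x y Uu) (NH_torsion_free NH y z Uu) (NH_torsion_free NH z x Uu).
rewrite (skew y (_ *m z)) (skew z (_ *m x)) (skew x (_ *m y)).
rewrite (NH_torsion_free NH x z Uu) (NH_torsion_free NH y x Uu) (NH_torsion_free NH z y Uu).
ring.
Qed.

Lemma Kahler_continuous u a b : U u -> {for u, continuous (fun v => Om v a b)}.
Proof.
move=> Uu.
have -> : (fun v => Om v a b) = fun v => \sum_c (G v a c * J1 v c b).
  by apply/funext => v; rewrite /Om mxE.
have := @cvg_big R^o 'I_m +%R 0 xpredT (@add_continuous R^o) _ (nbhs u)
  (index_enum 'I_m) (fun c v => G v a c * J1 v c b) (fun c => G u a c * J1 u c b) _.
apply => c _.
apply: continuousM.
  exact: (smooth_continuous (sG a c) Uu).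
exact: (smooth_continuous (sJ c b) Uu).
Qed.

Hypotheses (m0 : (0 < m)%N) (m4 : m <> 4%N) (m2 : m <> 2%N).

(** Near a point where an entry of Omega does not vanish, lambda is m / 4 times
    the quotient of two entries, hence has partial derivatives.  Differentiate
    m d omega = 4 lambda Omega: both d omega and Omega are closed, which leaves
    d lambda /\ Omega = 0. *)
Lemma chart_einstein_locally_constant u0 : U u0 -> exists lambda : R,
  \forall u \near u0, U u /\
  (forall y z, \tr (curv_trace_mx C y z u) = lambda * bil (G u) y z) /\
  (forall x y, m%:R * bil (dform om u) x y = 4 * lambda * bil (Om u) x y).
Proof.
move=> Uu0.
have [a [b ab]] : exists a b, Om u0 a b != 0.
  apply: contrapT => /forallNP H.
  have Om0 : Om u0 = 0.
    apply/matrixP => a b; rewrite [RHS]mxE; apply/eqP/negPn/negP.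
    by move: (H a) => /forallNP/(_ b).
  have := mulmxV (Kahler_unit Uu0); rewrite Om0 mul0mx.
  move=> /matrixP/(_ (Ordinal m0) (Ordinal m0)); rewrite !mxE eqxx => /eqP.
  by rewrite eq_sym oner_eq0.
pose h v : R := m%:R / 4 * (bil (dform om v) 'u_a 'u_b / bil (Om v) 'u_a 'u_b).
have kc : {for u0, continuous (fun v => Om v a b)} by exact: Kahler_continuous.
have near_ab : \forall u \near u0, U u /\ Om u a b != 0.
  apply: filterI; first exact: open_nbhs_nbhs.
  exact: (kc [set r : R | r != 0] (open_nbhs_nbhs (conj (@open_neq R 0) ab))).
have hP v : U v -> Om v a b != 0 ->
   (forall y z, \tr (curv_trace_mx C y z v) = h v * bil (G v) y z) /\
   (forall x y, m%:R * bil (dform om v) x y = 4 * h v * bil (Om v) x y).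
  move=> Uv vab; have [l [H1 H2]] := chart_einstein NH m0 m4 Uv.
  suff -> : h v = l by split=> // x y; rewrite H2 bil_mulr.
  have := H2 'u_a 'u_b; rewrite bil_mulr !bil_delta -/(Om v) /h !bil_delta => E.
  by rewrite mulf_div E; field; exact: vab.
have m0' : (m%:R : R) != 0 by rewrite pnatr_eq0 -lt0n.
exists (h u0).
suff hc : \forall u \near u0, h u = h u0.
  by apply: filterS (filterI near_ab hc) => u [[Uu uab] <-]; split=> //; exact: hP.
apply: locally_constant.
apply: filterS (near_join near_ab) => u Hu.
have [Uu uab] := nbhs_singleton Hu.
have dOm s t r : is_derive u s (fun v => bil (Om v) t r)
    ('D_s (fun v => bil (Om v) t r) u).
  by apply: derivableP; case: (is_derive_bil t r (Kahler_parallel s Uu)).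
have dB s t r : is_derive u s (fun v => bil (dform om v) t r)
    ('D_s (fun v => bil (dform om v) t r) u).
  by apply: derivableP; exact: (dform_derivable oU som Uu).
have dh s : is_derive u s h ('D_s h u).
  apply: derivableP; have -> : h = (m%:R / 4) \*: ((fun v => bil (dform om v) 'u_a 'u_b) *
      (fun v => (bil (Om v) 'u_a 'u_b)^-1)).
    by [].
  apply: derivableZ; apply: derivableM; first by case: (dB s 'u_a 'u_b).
  by apply: derivableV; [rewrite bil_delta | case: (dOm s 'u_a 'u_b)].
have D s t r : m%:R * 'D_s (fun v => bil (dform om v) t r) u =
   4 * ('D_s h u * bil (Om u) t r + h u * 'D_s (fun v => bil (Om v) t r) u).
  have [_ e1] := is_deriveZ m%:R (dB s t r).
  have [_ e2] := is_deriveZ 4 (is_deriveM (dh s) (dOm s t r)).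
  apply: etrans (esym e1) _; apply: etrans (etrans _ e2) _.
    apply: near_eq_derive; apply: filterS Hu => v [Uv vab].
    have [_ H] := hP v Uv vab.
    by rewrite [LHS]H -mulrA.
  by rewrite /GRing.scale/= addrC [X in X + _]mulrC.
have eta0 : \row_c 'D_('u_c) h u = 0.
  apply: (wedge_nondegenerate m2 (Kahler_unit Uu) (Kahler_skew Uu)) => x y z.
  have e c : (\row_c 'D_('u_c) h u) 0 c = 'D_('u_c) h u by rewrite mxE.
  rewrite !e -!(bil_delta (Om u)).
  have H1 := @dform_closed _ _ U om u 'u_x 'u_y 'u_z oU som Uu.
  have H2 := @Kahler_closed u 'u_x 'u_y 'u_z Uu.
  exact: (closed_multiple (D 'u_x 'u_y 'u_z) (D 'u_y 'u_z 'u_x) (D 'u_z 'u_x 'u_y) H1 H2).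
move=> c; split; first by case: (dh 'u_c).
by move/rowP/(_ c): eta0; rewrite !mxE.
Qed.

End KahlerForm.

(** * From charts to the manifold *)

Section Charts.
Context {R : realType} {m : nat} (M : smooth_manifold R m).
Implicit Types (i j : chart M) (p q : M) (V W : set M).

Lemma chartK i p : dom i p -> psi i (phi i p) = p.
Proof. by move=> ip; apply: phiK; rewrite inE. Qed.

Lemma chart_image_open i V : open V -> open (phi i @` (V `&` dom i)).
Proof.
move=> oV; rewrite openE => _ [p [Vp ip] <-].
rewrite /interior.
have U0 : nbhs (phi i p) (phi i @` dom i).
  by apply: open_nbhs_nbhs; split; [exact: phi_open | exists p].
have c : {for phi i p, continuous (psi i)}.
  by apply: (@psi_continuous _ _ M i); rewrite inE; exists p.
have V0 : nbhs (phi i p) (psi i @^-1` V).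
  by apply: c; rewrite chartK//; exact: open_nbhs_nbhs.
apply: filterS (filterI U0 V0) => _ [[q iq <-] Vq].
by exists q => //; split=> //; move: Vq; rewrite /= chartK.
Qed.

Lemma chart_imageP i V u : (phi i @` (V `&` dom i)) u ->
  [/\ V (psi i u), dom i (psi i u) & phi i (psi i u) = u].
Proof. by move=> [p [Vp ip] <-]; rewrite chartK. Qed.

Lemma phi_near i p (P : 'cV[R]_m -> Prop) : dom i p ->
  (\forall u \near phi i p, P u) -> \forall q \near p, P (phi i q).
Proof.
move=> ip; have : {for p, continuous (phi i)}.
  by apply: (@phi_continuous _ _ M i); rewrite inE.
by apply.
Qed.

End Charts.

Section ChartFields.
Context {R : realType} {m : nat} (M : smooth_manifold R m).
Variables (Gamma : christoffel_family M) (i : chart M) (V : set M).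
Hypothesis oV : open V.
Implicit Types (x y z : 'cV[R]_m) (p q : M).

Local Notation W := (V `&` dom i).
Local Notation U := (phi i @` W).

Definition chart_conn (a : 'I_m) (u : 'cV[R]_m) : 'M[R]_m :=
  \matrix_(c, b) Gamma i (psi i u) a b c 0.

Local Notation conn := (conn chart_conn).

Lemma const_vector_field x : vector_field i W (fun=> x).
Proof.
split=> [||a]; first by apply: openI => //; exact: dom_open.
  by move=> p [].
exact: smooth_cst.
Qed.

Lemma lie_derivative_cst X (c : R) p : lie_derivative i X (fun=> c) p = 0.
Proof.
rewrite /lie_derivative big1// => a _; rewrite /partial.
by rewrite [X in 'D_ _ X _](_ : _ = cst c)// derive_cst mulr0.
Qed.

Lemma bracket_cst x y : bracket i (fun=> x) (fun=> y) = fun=> 0.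
Proof.
apply/funext => p; apply/colP => c; rewrite !mxE.
by rewrite !lie_derivative_cst subrr.
Qed.

Lemma nabla_cst x (Y : M -> 'cV[R]_m) p : dom i p -> nabla Gamma i (fun=> x) Y p =
  (\sum_a x a 0 *: \col_c partial i a (fun q => Y q c 0) p) + conn x (phi i p) *m Y p.
Proof.
move=> ip; rewrite /nabla; congr (_ + _).
  by apply/colP => c; rewrite mxE summxE; apply: eq_bigr => a _; rewrite !mxE.
rewrite /conn mulmx_suml; apply: eq_bigr => a _; rewrite -scalemxAl.
apply/colP => c; rewrite !mxE summxE mulr_sumr; apply: eq_bigr => b _.
by rewrite !mxE chartK//; ring.
Qed.

Lemma nabla_cst_cst x y p : dom i p ->
  nabla Gamma i (fun=> x) (fun=> y) p = conn x (phi i p) *m y.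
Proof.
move=> ip; rewrite nabla_cst// big1 ?add0r// => a _.
rewrite [X in _ *: X](_ : _ = 0) ?scaler0//; apply/colP => c; rewrite !mxE.
by rewrite /partial [X in 'D_ _ X _](_ : _ = cst (y c 0))// derive_cst.
Qed.

Hypothesis sC : forall a, smooth_mx U (chart_conn a).

Let oU : open U. Proof. exact: chart_image_open. Qed.

Let near_U p (P : 'cV[R]_m -> Prop) : W p -> (forall u, U u -> P u) ->
  \forall u \near phi i p, P u.
Proof.
move=> Wp h; have : \forall u \near phi i p, U u.
  by apply: open_nbhs_nbhs; split=> //; exists p.
exact: filterS.
Qed.

(** Inside the outer derivative the inner one matters only near p, where it
    is the image of z under the connection matrix. *)
Lemma nabla_nabla_cst x y z p : W p ->
  nabla Gamma i (fun=> x) (nabla Gamma i (fun=> y) (fun=> z)) p =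
  'D_x (conn y) (phi i p) *m z + conn x (phi i p) *m (conn y (phi i p) *m z).
Proof.
move=> Wp; have Up : U (phi i p) by exists p.
have ip := Wp.2.
rewrite nabla_cst// nabla_cst_cst//; congr (_ + _).
rewrite (conn_deriveE oU sC x y Up) mulmx_suml; apply: eq_bigr => a _.
rewrite -scalemxAl; congr (_ *: _); apply/colP => c; rewrite mxE /partial.
have dy : derivable (conn y) (phi i p) 'u_a by exact: (conn_derivable oU sC).
have [d e] := is_derive_mulmx (derivableP dy) (is_derive_cst z (phi i p) 'u_a).
rewrite mulmx0 addr0 in e.
apply: etrans (congr1 (fun B : 'cV[R]_m => B c 0) e); apply: etrans (esym (derive_mxE c 0 d)).
apply: near_eq_derive; apply: near_U => // u Uu.
by have [Vu iu uE] := chart_imageP Uu; rewrite /= nabla_cst_cst// uE.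
Qed.

Lemma curvature_chart x y z p : W p ->
  curvature Gamma i p x y z = curv chart_conn x y (phi i p) *m z.
Proof.
move=> Wp; have ip := Wp.2; rewrite /curvature /curvature_op bracket_cst nabla_cst_cst//.
rewrite (nabla_nabla_cst x y z Wp) (nabla_nabla_cst y x z Wp).
have -> : conn 0 (phi i p) = 0.
  by rewrite /conn big1// => a _; rewrite mxE scale0r.
rewrite mul0mx subr0 /curv !mulmxDl !mulNmx !mulmxA.
move: ('D_x _ _ *m z) ('D_y _ _ *m z) (conn x _ *m _ *m z) (conn y _ *m _ *m z) => a b c d.
by apply/matrixP => r s; rewrite !mxE; ring.
Qed.

(** The two contractions with the inverse metric and the metric cancel, so
    the Ricci tensor is a trace that does not involve g. *)
Lemma ricci_chart g y z p : W p -> (g i p)^T = g i p -> g i p \in unitmx ->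
  ricci g Gamma i p y z = \tr (curv_trace_mx chart_conn y z (phi i p)).
Proof.
move=> Wp gT gu; rewrite /ricci /mxtrace; apply: eq_bigr => a _.
rewrite mxE -curvature_chart//; set v := curvature _ _ _ _ _ _.
have -> : v a 0 = (invmx (g i p) *m g i p *m v) a 0 by rewrite mulVmx// mul1mx.
rewrite -mulmxA mxE; apply: eq_bigr => b _; congr (_ * _).
rewrite /curvature4 -/v /bil -colE [LHS]mxE -[in LHS]gT -trmx_mul [LHS]mxE.
by [].
Qed.

End ChartFields.

Section NHManifold.
Context {R : realType} {n : nat} (M : smooth_manifold R (4 * n)).
Variables (J : 'I_3 -> matrix_family M) (g : matrix_family M)
  (gs : 'I_3 -> matrix_family M) (Gamma : christoffel_family M).
Hypotheses (n2 : (8 <= 4 * n)%N) (HJ : almost_hypercomplex J)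
  (HG : NH_metric_structure J g gs) (LC : levi_civita g Gamma).
Local Notation m := (4 * n)%N.
Implicit Types (i j : chart M) (p q : M) (x y z : 'cV[R]_m).

Let j1 : 'I_3 := ord0.
Let j2 : 'I_3 := ordS j1.
Let j3 : 'I_3 := ordS j2.

Let j31 : ordS j3 = j1. Proof. exact: val_inj. Qed.

(** Since J squares to -1, compatibility of J with g is the same as J being
    skew (eps = 1) or self-adjoint (eps = -1) for g. *)
Lemma NH_algebra_at i p : dom i p -> NH_algebra (g i p) (J j1 i p) (J j2 i p) (J j3 i p).
Proof.
move=> ip.
have [A1 A2 A3] := HJ.2 j1 i p ip; have [B1 B2 B3] := HJ.2 j2 i p ip.
have [C1 C2 C3] := HJ.2 j3 i p ip.
rewrite -/j2 -/j3 in A2 A3; rewrite -/j3 j31 in B2 B3; rewrite j31 -/j2 in C2 C3.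
have [_ gsym gunit] := NH_metric HG.
have adj al : (J al i p)^T *m g i p = - eps al *: (g i p *m J al i p).
  have E : g i p = eps al *: ((J al i p)^T *m g i p *m J al i p).
    apply: bil_inj => x y; rewrite (NH_compat HG al ip x y) bil_mull bil_mulr.
    by rewrite /bil -[in RHS]scalemxAr -[in RHS]scalemxAl [in RHS]mxE.
  have [JJ _ _] := HJ.2 al i p ip.
  have ee : eps al * eps al = 1 :> R by rewrite /eps; case: ifP => _; ring.
  have -> : g i p *m J al i p = - eps al *: ((J al i p)^T *m g i p).
    by rewrite {1}E -scalemxAl -mulmxA JJ mulmxN mulmx1 scalerN scaleNr.
  by rewrite scalerA mulrNN ee scale1r.
have a1 := adj j1; have a2 := adj j2; have a3 := adj j3.
rewrite /eps/= scaleN1r in a1; rewrite /eps/= opprK scale1r in a2.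
rewrite /eps/= opprK scale1r in a3.
apply: NHAlgebra => //.
- exact: gsym.
- exact: gunit.
- by rewrite [in RHS]C3 opprK.
- by rewrite [in RHS]A3 opprK.
- by rewrite [in RHS]B3 opprK.
Qed.

Section Local.
Variables (V : set M) (om : 'I_3 -> covector_family M).
Hypotheses (oV : open V) (Hom : forall al, one_form V (om al))
  (QK : forall al i W X Y, W `<=` V -> vector_field i W X -> vector_field i W Y ->
     forall p, W p ->
     let be := ordS al in let ga := ordS be in
     nabla_endo Gamma (J al) i X Y p =
     ev (om ga i p) (X p) *: (J be i p *m Y p) -
     ev (om be i p) (X p) *: (J ga i p *m Y p)).
Variable i : chart M.

Local Notation W := (V `&` dom i).
Local Notation U := (phi i @` W).
Local Notation C := (chart_conn Gamma i).
Local Notation pull F := (fun u => F i (psi i u)).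

Lemma open_chart : open U. Proof. exact: chart_image_open. Qed.

Let sub_U : U `<=` phi i @` dom i.
Proof. by move=> _ [p [_ ip] <-]; exists p. Qed.

Lemma smooth_chart_conn a : smooth_mx U (C a).
Proof.
move=> c b; apply: (smooth_on_sub sub_U); case: LC => -[H _] _ _.
rewrite (_ : (fun u => _) = (fun p => Gamma i p a b c 0) \o psi i); first exact: H.
by apply/funext => u; rewrite mxE.
Qed.

Lemma smooth_metric : smooth_mx U (pull g).
Proof.
move=> a b; apply: (smooth_on_sub sub_U).
by have [[H _] _ _] := NH_metric HG; exact: H.
Qed.

Lemma smooth_structure al : smooth_mx U (pull (J al)).
Proof.
by move=> a b; apply: (smooth_on_sub sub_U); exact: (HJ.1 al).1.
Qed.

Lemma smooth_form al : smooth_mx U (pull (om al)).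
Proof. by move=> a b; rewrite (ord1 a); exact: (Hom al).1. Qed.

Lemma torsion_free_chart u x y : U u -> conn C x u *m y = conn C y u *m x.
Proof.
move=> Uu; have [Vp ip uE] := chart_imageP Uu.
have Wp : W (psi i u) by [].
have [_ H _] := LC.
have := H i W (fun=> x) (fun=> y) (const_vector_field i oV x) (const_vector_field i oV y) _ Wp.
rewrite !nabla_cst_cst// bracket_cst uE => /eqP; rewrite subr_eq0 => /eqP.
by [].
Qed.

Lemma metric_chart x u : U u -> 'D_x (pull g) u =
  (conn C x u)^T *m g i (psi i u) + g i (psi i u) *m conn C x u.
Proof.
move=> Uu; have [Vp ip uE] := chart_imageP Uu.
have Wp : W (psi i u) by [].
have [_ _ H] := LC.
apply/matrixP => b c.
have {H} := H i W (fun=> x) (fun=> 'u_b) (fun=> 'u_c) (const_vector_field i oV x)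
  (const_vector_field i oV _) (const_vector_field i oV _) _ Wp.
rewrite !nabla_cst_cst// uE bil_mull bil_mulr !bil_delta => E.
rewrite [RHS]mxE -E /lie_derivative (smooth_mx_deriveE x open_chart smooth_metric Uu) summxE.
apply: eq_bigr => a _; rewrite mxE; congr (_ * _).
rewrite derive_mxE; last exact: (smooth_mx_derivable open_chart smooth_metric Uu).
rewrite /partial uE; apply: (congr1 (fun f => 'D_('u_a) f u)).
by apply/funext => v; rewrite /= bil_delta.
Qed.

Lemma structure_chart al x u : U u -> 'D_x (pull (J al)) u =
  J al i (psi i u) *m conn C x u - conn C x u *m J al i (psi i u) +
  (ev (om (ordS (ordS al)) i (psi i u)) x *: J (ordS al) i (psi i u) -
   ev (om (ordS al) i (psi i u)) x *: J (ordS (ordS al)) i (psi i u)).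
Proof.
move=> Uu; have [Vp ip uE] := chart_imageP Uu.
have Wp : W (psi i u) by [].
apply: mulmx_delta_inj => b.
have WV : W `<=` V by move=> q [].
have := QK al WV (const_vector_field i oV x) (const_vector_field i oV 'u_b) Wp.
rewrite /= /nabla_endo nabla_cst// nabla_cst_cst// uE => E.
have D : \sum_a x a 0 *:
    (\col_c partial i a (fun q => (J al i q *m ('u_b : 'cV[R]_m)) c 0) (psi i u))
    = 'D_x (pull (J al)) u *m ('u_b : 'cV[R]_m).
  rewrite (smooth_mx_deriveE x open_chart (smooth_structure al) Uu) mulmx_suml.
    apply: eq_bigr => a _; rewrite -scalemxAl; congr (_ *: _); apply/colP => c.
  rewrite mxE -colE [RHS]mxE derive_mxE; last first.
    exact: (smooth_mx_derivable open_chart (smooth_structure al) Uu).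
  rewrite /partial uE; apply: (congr1 (fun f => 'D_('u_a) f u)).
  by apply/funext => v; rewrite /= -colE mxE.
rewrite D in E.
rewrite mulmxDl mulmxBl -!mulmxA mulmxBl -!scalemxAl -E; set B := 'D_x _ u *m _.
by move: B => B; apply/matrixP => r s; rewrite !mxE; ring.
Qed.

Lemma forms_vanish x u : U u -> ev (om j3 i (psi i u)) x = 0 /\ ev (om j2 i (psi i u)) x = 0.
Proof.
move=> Uu; have [Vp ip uE] := chart_imageP Uu.
have m0 : (0 < m)%N by exact: leq_trans n2.
have dJ : derivable (pull (J j1)) u x.
  exact: (smooth_mx_derivable open_chart (smooth_structure j1) Uu).
have dG : derivable (pull g) u x.
  exact: (smooth_mx_derivable open_chart smooth_metric Uu).
apply: (NH_connection_reduces m0 (NH_algebra_at ip) (metric_chart x Uu) (structure_chart j1 x Uu)).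
have d1 := is_derive_mulmx (is_derive_trmx (derivableP dJ)) (derivableP dG).
have d2 := is_derive_mulmx (derivableP dG) (derivableP dJ).
have [_ e] := is_deriveD d1 d2.
apply: etrans (esym e) _; apply: etrans (derive_cst (0 : 'M[R]_m) u x).
apply: near_eq_derive.
have : \forall v \near u, U v by apply: open_nbhs_nbhs; split=> //; exact: open_chart.
apply: filterS => v Uv; have [_ iv _] := chart_imageP Uv.
have E := NH_adj1 (NH_algebra_at iv).
by apply/eqP; rewrite addr_eq0; apply/eqP.
Qed.

Lemma NH_chart_at : NH_chart U C (pull g) (pull (J j1)) (pull (J j2)) (pull (J j3))
  (pull (om j1)).
Proof.
apply: NHChart.
- exact: open_chart.
- exact: smooth_chart_conn.
- exact: smooth_metric.
- exact: smooth_structure.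
- exact: smooth_structure.
- exact: smooth_structure.
- exact: smooth_form.
- by move=> u Uu; have [_ ip _] := chart_imageP Uu; exact: NH_algebra_at.
- by move=> u x y Uu; exact: torsion_free_chart.
- by move=> x u Uu; exact: metric_chart.
- move=> x u Uu; case: (forms_vanish x Uu) => o3v o2v.
  apply: etrans (structure_chart j1 x Uu) _; rewrite -/j2 -/j3 o3v o2v.
  by rewrite !scale0r subr0 addr0.
- move=> x u Uu; case: (forms_vanish x Uu) => o3v o2v.
  apply: etrans (structure_chart j2 x Uu) _; rewrite -/j3 j31 o3v.
  by rewrite scale0r subr0.
- move=> x u Uu; case: (forms_vanish x Uu) => o3v o2v.
  apply: etrans (structure_chart j3 x Uu) _; rewrite j31 -/j2 o2v.
  by rewrite scale0r sub0r.
Qed.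

End Local.

Section Patch.
Variables (V : set M) (om : 'I_3 -> covector_family M).
Hypotheses (oV : open V) (Hom : forall al, one_form V (om al))
  (QK : forall al i W X Y, W `<=` V -> vector_field i W X -> vector_field i W Y ->
     forall p, W p ->
     let be := ordS al in let ga := ordS be in
     nabla_endo Gamma (J al) i X Y p =
     ev (om ga i p) (X p) *: (J be i p *m Y p) -
     ev (om be i p) (X p) *: (J ga i p *m Y p)).

Local Notation curvature_form i q := (dform (fun u => om j1 i (psi i u)) (phi i q)).

(** The second equation determines lambda from two 2-forms, whose change of
    charts is easier than that of the Ricci tensor. *)
Definition einstein_at i q (lambda : R) : Prop :=
  (forall y z, ricci g Gamma i q y z = lambda * bil (g i q) y z) /\
  (m%:R *: curvature_form i q = (4 * lambda) *: (g i q *m J j1 i q)).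

Let m0 : (0 < m)%N. Proof. exact: leq_trans n2. Qed.
Let m4 : m <> 4%N. Proof. by move=> e; move: n2; rewrite e. Qed.
Let m2 : m <> 2%N. Proof. by move=> e; move: n2; rewrite e. Qed.

Lemma einstein_atP i q (lambda : R) : V q -> dom i q ->
  (forall y z, \tr (curv_trace_mx (chart_conn Gamma i) y z (phi i q)) =
     lambda * bil (g i (psi i (phi i q))) y z) ->
  (forall x y, m%:R * bil (curvature_form i q) x y =
     4 * lambda * bil (g i (psi i (phi i q)) *m J j1 i (psi i (phi i q))) x y) ->
  einstein_at i q lambda.
Proof.
move=> Vq iq H1 H2; rewrite !chartK// in H1 H2.
have A := NH_algebra_at iq.
split=> [y z|].
  rewrite (ricci_chart oV (smooth_chart_conn V i) y z (conj Vq iq)) ?(NH_sym A) ?(NH_unit A)//.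
by apply/matrixP => a b; have := H2 'u_a 'u_b; rewrite !bil_delta => e; rewrite [RHS]mxE [LHS]mxE.
Qed.

Lemma einstein_at_exists i q : V q -> dom i q -> exists lambda, einstein_at i q lambda.
Proof.
move=> Vq iq; have Uq : (phi i @` (V `&` dom i)) (phi i q) by exists q.
have [l [H1 H2]] := chart_einstein (NH_chart_at oV Hom QK i) m0 m4 Uq.
exists l; apply: einstein_atP => // x y; rewrite H2 bil_mulr; by [].
Qed.

Lemma einstein_at_locally i p : V p -> dom i p ->
  exists lambda, \forall q \near p, [/\ V q, dom i q & einstein_at i q lambda].
Proof.
move=> Vp ip; have Up : (phi i @` (V `&` dom i)) (phi i p) by exists p.
have [l H] := chart_einstein_locally_constant (NH_chart_at oV Hom QK i) m0 m4 m2 Up.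
exists l.
have Wp : \forall q \near p, V q /\ dom i q.
  apply: open_nbhs_nbhs; split; last by split.
  by apply: openI => //; exact: dom_open.
apply: filterS (filterI Wp (phi_near ip H)) => q [[Vq iq] [_ [H1 H2]]].
by split=> //; exact: einstein_atP.
Qed.

(** In chart i the form omega is the pullback of its expression in chart j. *)
Lemma curvature_form_change i j q : V q -> dom i q -> dom j q ->
  curvature_form i q = (jac i j q)^T *m curvature_form j q *m jac i j q.
Proof.
move=> Vq iq jq.
pose T u := phi j (psi i u).
pose O := phi i @` (dom j `&` dom i).
have oO : open O by apply: chart_image_open; exact: dom_open.
have sT : smooth_mx O T.
  move=> a b; rewrite (ord1 b).
  rewrite /O setIC; exact: transition_smooth.
have Tq : T (phi i q) = phi j q by rewrite /T chartK.
have jacE u : O u -> jac i j (psi i u) = jacobian_mx T u.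
  move=> Ou; have [_ _ uE] := chart_imageP Ou.
  by apply/matrixP => a b; rewrite !mxE /partial uE.
have Oq : O (phi i q) by exists q.
rewrite -[in jac i j q](chartK iq) jacE// -Tq.
apply: (@dform_pullback _ _ (phi j @` (V `&` dom j)) O) => //.
- exact: open_chart.
- exact: smooth_form.
- by rewrite Tq; exists q.
have : \forall u \near phi i q, (phi i @` ((V `&` dom j) `&` dom i)) u.
  apply: open_nbhs_nbhs; split; last by exists q.
  by apply: chart_image_open; apply: openI => //; exact: dom_open.
apply: filterS => u Uu; have [[Vu ju] iu uE] := chart_imageP Uu.
have [_ Ho] := Hom j1.
by rewrite (Ho i j) // /T chartK// jacE//; exists (psi i u).
Qed.

Lemma einstein_at_chart_change i j q l l' : V q -> dom i q -> dom j q ->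
  einstein_at i q l -> einstein_at j q l' -> l = l'.
Proof.
move=> Vq iq jq [_ Ei] [_ Ej].
have [[_ tg] _ _] := NH_metric HG; have [_ tJ] := HJ.1 j1.
have Om : g i q *m J j1 i q = (jac i j q)^T *m (g j q *m J j1 j q) *m jac i j q.
  by rewrite (tg i j q iq jq) -!mulmxA (tJ i j q iq jq).
have E : (4 * l) *: (g i q *m J j1 i q) = (4 * l') *: (g i q *m J j1 i q).
  rewrite -Ei (curvature_form_change Vq iq jq) Om scalemxAl scalemxAr Ej.
  by rewrite -scalemxAr -scalemxAl.
have A := NH_algebra_at iq.
have gJ0 : g i q *m J j1 i q != 0.
  apply/eqP => gJ; have : g i q *m J j1 i q *m J j1 i q = 0 by rewrite gJ mul0mx.
  rewrite -mulmxA (NH_J11 A) mulmxN mulmx1 => /eqP; rewrite oppr_eq0 => /eqP g0.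
  have := mulmxV (NH_unit A); rewrite g0 mul0mx.
  move=> /matrixP/(_ (Ordinal m0) (Ordinal m0)); rewrite !mxE eqxx => /eqP.
  by rewrite eq_sym oner_eq0.
move/eqP: E; rewrite -subr_eq0 -scalerBl scaler_eq0 (negbTE gJ0) orbF -mulrBr.
by rewrite mulf_eq0 pnatr_eq0/= subr_eq0 => /eqP.
Qed.

End Patch.

Definition einstein_value q (lambda : R) : Prop := forall i, dom i q ->
  forall y z, ricci g Gamma i q y z = lambda * bil (g i q) y z.

Lemma einstein_value_unique q l l' : einstein_value q l -> einstein_value q l' -> l = l'.
Proof.
have [i iq] := dom_cover q => /(_ i iq) H /(_ i iq) H'.
have A := NH_algebra_at iq.
have m0 : (0 < m)%N by exact: leq_trans n2.
have [y [z yz]] : exists y z, bil (g i q) y z != 0.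
  apply: contrapT => /forallNP h.
  have g0 : g i q = 0.
    apply: bil_inj => y z; move: (h y) => /forallNP/(_ z)/negP/negPn/eqP ->.
    by rewrite /bil mulmx0 mul0mx mxE.
  have := mulmxV (NH_unit A); rewrite g0 mul0mx.
  move=> /matrixP/(_ (Ordinal m0) (Ordinal m0)); rewrite !mxE eqxx => /eqP.
  by rewrite eq_sym oner_eq0.
by apply: (mulIf yz); rewrite -H H'.
Qed.

Hypothesis QK : quaternionic_kahler J Gamma.

Lemma einstein_value_locally p : exists lambda, \forall q \near p, einstein_value q lambda.
Proof.
have [V [om [oV Vp Hom H]]] := QK p; have [i ip] := dom_cover p.
have [l Hl] := einstein_at_locally oV Hom H Vp ip.
exists l; apply: filterS Hl => q [Vq iq Hq] j jq.
have [l' Hl'] := einstein_at_exists oV Hom H Vq jq.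
by rewrite (einstein_at_chart_change oV Hom Vq iq jq Hq Hl'); case: Hl'.
Qed.

(** On a component, the points with the value of lambda found at p form a set
    that is open and whose complement is open. *)
Lemma NH_Einstein : Einstein g Gamma.
Proof.
move=> p; have [l Hl] := einstein_value_locally p.
have vp : einstein_value p l := nbhs_singleton Hl.
exists l; set A := connected_component _ p.
suff E : A `&` [set q | einstein_value q l] = A.
  move=> i q Aq iq; move: (Aq); rewrite -[X in X q]E => -[_]; exact.
have cA : connected A by exact: component_connected.
apply: cA.
- by exists p; split=> //; exact: connected_component_refl.
- exists [set q | einstein_value q l] => //.
  rewrite openE => q vq; have [l' Hl'] := einstein_value_locally q.
  have -> // : l = l' := einstein_value_unique vq (nbhs_singleton Hl').
- exists [set q | einstein_value q l] => //.
  rewrite -[X in closed X]setCK; apply: open_closedC.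
  rewrite openE => q nvq; have [l' Hl'] := einstein_value_locally q.
  have vq := nbhs_singleton Hl'.
  apply: filterS Hl' => r vr vr'; apply: nvq.
  by have -> : l = l' := einstein_value_unique vr' vr.
Qed.

End NHManifold.

Theorem theorem2p7 (R : realType) (n : nat) (M : smooth_manifold R (4 * n))
    (J : 'I_3 -> matrix_family M) (g : matrix_family M)
    (gs : 'I_3 -> matrix_family M) (Gamma : christoffel_family M) :
  (8 <= 4 * n)%N ->
  almost_hypercomplex J ->
  NH_metric_structure J g gs ->
  levi_civita g Gamma ->
  quaternionic_kahler J Gamma ->
  Einstein g Gamma.
Proof. by move=> n2 HJ HG LC QK; exact: NH_Einstein n2 HJ HG LC QK. Qed.
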